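(* Let $X\subset\mathbb{R}^d$ be compact and convex with nonempty interior, and let $\Phi=\{\varphi_j^{(n)}\}_{n\in\mathbb{N},\,j\in I^{(n)}}$ be a nonautonomous conformal IFS on $X$ with all maps $\varphi_j^{(n)}$ injective. Let $(\beta_n)_{n\ge1}$, $\beta_n\colon I^{(n,\infty)}\to(0,\infty)$, be a sequence of functions, let $\xi^{(n)}\in I^{(n+1,\infty)}$, and put $x^{(n)}=\pi_n(\xi^{(n)})\in J_n$. Assume: (1) (Open Set Condition) for all $n$ and all $i\ne j$ in $I^{(n)}$, $\varphi_i^{(n)}(\mathrm{int}\,X)\cap\varphi_j^{(n)}(\mathrm{int}\,X)=\emptyset$; (2) (Uniform contraction) there is $\theta>0$ with $\overline{\kappa}_{(n)}\le e^{-\theta}$ for all $n$; (3) (Exponentially shrinking condition) there are numbers $\underline\alpha,\overline\alpha$ with $0<\underline{\alpha}\le\beta_k(\xi)+\log\underline{\kappa}_{(k)}\le\beta_k(\xi)+\log\overline{\kappa}_{(k)}\le\overline{\alpha}$ for all $k\ge 1$ and all $\xi\in I^{(k,\infty)}$; (4) (Linear variation condition) $\lim_{n\to\infty}\frac1n\left(\sup_{\xi\in I^\infty}S_n\beta(\xi)-\inf_{\xi\in I^\infty}S_n\beta(\xi)\right)=0$; (5) (Non-empty quasi middle) there is $\varepsilon>0$ such that $J_n\cap X_\varepsilon\ne\emptyset$ for all $n$, and the points are chosen so that $x^{(n)}\in J_n\cap X_\varepsilon$ for all $n$; (6) (Bounded distortion) there is $K\ge1$ such that $|D\varphi_\omega^n(x)|\le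 K|D\varphi_\omega^n(y)|$ for all $n\in\mathbb{N}$, $\omega\in I^n$, $x,y\in X$; (7) the sequence $\left(\overline{\kappa}_n/\underline{\kappa}_n\right)_{n\ge1}$ is bounded; (8) there exists an $h$-Ahlfors regular measure $\mu_h$ with $h=\mathrm{HD}(J)$ and $\mathrm{supp}(\mu_h)=J$. Then the shrinking target set $\mathscr{D}$ satisfies $\mathrm{HD}(\mathscr{D})=b$, where $b$ is the Bowen parameter.
   Context: Nonautonomous conformal IFS: $X\subset\mathbb{R}^d$ is compact, convex, with nonempty interior; $V\supset X$ is a bounded, open, connected set; $(I^{(n)})_{n\in\mathbb{N}}$ is a sequence of finite alphabets; for every $n$ and $j\in I^{(n)}$, $\varphi_j^{(n)}\colon V\to V$ is a conformal contraction (each derivative $D\varphi_j^{(n)}(x)$ is a similarity, with scaling factor denoted $|D\varphi_j^{(n)}(x)|$) with $\varphi_j^{(n)}(X)\subseteq X$. Words: $I^n=I^{(1)}\times\cdots\times I^{(n)}$, $I^{(k,n)}=I^{(k)}\times\cdots\times I^{(n)}$ ($n=\infty$ allowed), $I^\infty=I^{(1,\infty)}$. For $\omega\in I^n$, $\varphi_\omega^n=\varphi_{\omega_1}^{(1)}\circ\cdots\circ\varphi_{\omega_n}^{(n)}$; for $\omega\in I^{(m,n)}$, $\varphi_\omega^{(m,n)}=\varphi^{(m)}_{\omega_1}\circ\cdots\circ\varphi^{(n)}_{\omega_{n-m+1}}$. $\sigma$ is the shift deleting the first letter; $\xi|_k$ is the word of the first $k$ letters of $\xi$; $\omega\xi$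 is concatenation. Constants: $\underline{\kappa}_{(n)}=\min_{j\in I^{(n)}}\inf_{x\in X}|D\varphi_j^{(n)}(x)|$, $\overline{\kappa}_{(n)}=\max_{j\in I^{(n)}}\sup_{x\in X}|D\varphi_j^{(n)}(x)|$, $\underline{\kappa}_n=\min_{\omega\in I^n}\inf_{x\in X}|D\varphi_\omega^n(x)|$, $\overline{\kappa}_n=\max_{\omega\in I^n}\sup_{x\in X}|D\varphi_\omega^n(x)|$. Limit sets: $J=\bigcap_{n\ge1}\bigcup_{\omega\in I^n}\varphi_\omega^n(X)$. For $\xi\in I^{(n+1,\infty)}$, $\pi_n(\xi)$ is the unique point of $\bigcap_{k\ge1}\varphi_{\xi|_k}^{(n+1,n+k)}(X)$, and $J_n=\pi_n(I^{(n+1,\infty)})$. For $\varepsilon>0$, $X_\varepsilon=X\setminus\bigcup_{y\in\mathbb{R}^d\setminus X}B(y,\varepsilon)$, where $B(y,r)$ is the open ball. Shrinking targets: $S_n\beta(\xi)=\beta_1(\xi)+\beta_2(\sigma\xi)+\cdots+\beta_n(\sigma^{n-1}\xi)$ for $\xi\in I^\infty$. For $\omega\in I^n$, $B_\omega=B\left(\varphi_\omega^n(x^{(n)}),\,e^{-S_n\beta(\omega\xi^{(n)})}\right)$, and $\mathscr{D}=\bigcap_{N\ge1}\bigcup_{n\ge N}\bigcup_{\omega\in I^n}B_\omega$. Pressure: $\overline{P}_\beta(t)=\limsup_{n\to\infty}\frac1n\log\sum_{\omega\in I^n}e^{-tS_n\beta(\omega\xi^{(n)})}$ for $t\ge0$.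 The Bowen parameter is $b=\inf\{t\ge0:\overline{P}_\beta(t)<0\}=\sup\{t\ge0:\overline{P}_\beta(t)>0\}\in[0,\infty]$ (with $\inf\emptyset=\infty$, $\sup\emptyset=0$); the two expressions agree under hypotheses (2) and (3). $\mathrm{HD}$ denotes Hausdorff dimension. A Borel measure $\mu$ is $h$-Ahlfors regular if there is $C\ge1$ with $C^{-1}r^h\le\mu(B(x,r))\le Cr^h$ for all $x\in\mathrm{supp}(\mu)$ and $0<r\le1$. *)

(* Defs.v *)
From HB Require Import structures.
From mathcomp Require Import all_boot all_order all_algebra.
From mathcomp Require Import all_classical all_reals all_analysis.

Set Implicit Arguments.
Unset Strict Implicit.
Unset Printing Implicit Defensive.

Import Order.TTheory GRing.Theory Num.Theory.
Import numFieldNormedType.Exports.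

Local Open Scope classical_set_scope.
Local Open Scope ring_scope.

(* The library norm on 'rV[R]_d is the sup norm. It induces the usual topology,
   so open, compact, connected, bounded and differentiable keep their library
   meaning; everything metric (balls, diameters, similarities) uses the
   Euclidean norm below. *)
Section euclidean.
Context {R : realType} {d : nat}.
Implicit Types (x y : 'rV[R]_d) (A V : set 'rV[R]_d) (f L : 'rV[R]_d -> 'rV[R]_d).

Definition enorm x : R := Num.sqrt (\sum_(i < d) x ord0 i ^+ 2).

Definition eball x (r : R) : set 'rV[R]_d := [set y | enorm (y - x) < r].

Definition similarity (c : R) L : Prop :=
  0 < c /\ forall v, enorm (L v) = c * enorm v.

(* |Df(x)|; unique when d > 0 and the derivative is a similarity. *)
Definition conformal_factor f x : R := xget 0 [set c | similarity c ('d f x)].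

Definition conformal_contraction V f : Prop :=
  [/\ forall x, V x -> V (f x),
      forall x, V x -> differentiable f x /\ exists c, similarity c ('d f x) &
      exists s : R, s < 1 /\
        forall x y, V x -> V y -> enorm (f x - f y) <= s * enorm (x - y)].

(* X_eps *)
Definition inner_part A (eps : R) : set 'rV[R]_d :=
  A `\` \bigcup_(y in ~` A) eball y eps.

Definition ediam A : \bar R :=
  ereal_sup [set (enorm (p.1 - p.2))%:E | p in A `*` A].

(* The empty set contributes 0 and a singleton 0 `^ 0 = 1 when s = 0. *)
Definition diam_pow (s : R) A : \bar R :=
  if A == set0 then 0%E else poweR (ediam A) s.

Definition hausdorff_content (s delta : R) A : \bar R :=
  ereal_inf [set (\sum_(0 <= i <oo) diam_pow s (U i))%E
            | U in [set U : nat -> set 'rV[R]_d |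
                (forall i, (ediam (U i) <= delta%:E)%E) /\ A `<=` \bigcup_i U i]].

Definition hausdorff_measure (s : R) A : \bar R :=
  ereal_sup [set hausdorff_content s delta A | delta in [set e : R | 0 < e]].

Definition hausdorff_dim A : \bar R :=
  ereal_inf [set s%:E | s in [set s : R | 0 <= s /\ hausdorff_measure s A = 0%E]].

Definition borelRd := g_sigma_algebraType (@open 'rV[R]_d).

Definition msupport (mu : {measure set borelRd -> \bar R}) : set 'rV[R]_d :=
  [set x | forall U : set 'rV[R]_d, open U -> U x -> (0 < mu U)%E].

Definition ahlfors_regular (h : R) (mu : {measure set borelRd -> \bar R}) : Prop :=
  exists C : R, 1 <= C /\
    forall x, msupport mu x -> forall r : R, 0 < r -> r <= 1 ->
      ((C^-1 * r `^ h)%:E <= mu (eball x r))%E /\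
      (mu (eball x r) <= (C * r `^ h)%:E)%E.

End euclidean.

(* The alphabets are subsets of a common letter type T, indexed from 1: I n is
   used only for n >= 1, and similarly for the other sequences. A word
   of I^(m), ..., I^(m+n-1) is a sequence of length n; an infinite word of
   I^(m) x I^(m+1) x ... is a function nat -> T whose k-th value is in
   I^(m+k). *)
Section words.
Context {T : Type}.
Implicit Types (I : nat -> set T) (w : seq T) (xi : nat -> T).

Fixpoint admissible I (m : nat) w : Prop :=
  if w is a :: w' then I m a /\ admissible I m.+1 w' else True.

Definition words I (m n : nat) : set (seq T) :=
  [set w | size w = n /\ admissible I m w].

Definition infwords I (m : nat) : set (nat -> T) :=
  [set xi | forall k, I (m + k)%N (xi k)].

Definition wshift xi : nat -> T := fun k => xi k.+1.

Definition word_cat w xi : nat -> T := fun k => nth (xi (k - size w)%N) w k.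

End words.

Section ifs.
Context {R : realType} {d : nat} {T : choiceType}.
Implicit Types (X V : set 'rV[R]_d) (I : nat -> set T).
Implicit Types (phi : nat -> T -> 'rV[R]_d -> 'rV[R]_d).

(* phi_w^(m, m + size w - 1) *)
Fixpoint word_map phi (m : nat) (w : seq T) : 'rV[R]_d -> 'rV[R]_d :=
  if w is a :: w' then phi m a \o word_map phi m.+1 w' else id.

Definition conformal_ifs X V I phi : Prop :=
  [/\ [/\ compact X,
          convex_set (X : set (convex_lmodType 'rV[R]_d)) & X° !=set0],
      [/\ X `<=` V, bounded_set V, open V & connected V],
      forall n, (0 < n)%N -> finite_set (I n) /\ I n !=set0 &
      forall n j, (0 < n)%N -> I n j ->
        conformal_contraction V (phi n j) /\ phi n j @` X `<=` X].

(* Suffix 1: the constants of the single n-th alphabet; without it, those of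
   the words of length n. Inner inf/sup range over a nonempty set bounded by 0
   and 1, and the outer ones over finitely many values. *)
Definition kappa_low1 X I phi (n : nat) : R :=
  inf [set inf [set conformal_factor (phi n j) x | x in X] | j in I n].
Definition kappa_up1 X I phi (n : nat) : R :=
  sup [set sup [set conformal_factor (phi n j) x | x in X] | j in I n].

Definition kappa_low X I phi (n : nat) : R :=
  inf [set inf [set conformal_factor (word_map phi 1 w) x | x in X] | w in words I 1 n].
Definition kappa_up X I phi (n : nat) : R :=
  sup [set sup [set conformal_factor (word_map phi 1 w) x | x in X] | w in words I 1 n].

Definition limit_set X I phi : set 'rV[R]_d :=
  \bigcap_(n in [set n | (0 < n)%N])
    \bigcup_(w in words I 1 n) (word_map phi 1 w @` X).

(* pi_n; the intersection is a singleton under uniform contraction. *)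
Definition coding X phi (n : nat) (xi : nat -> T) : 'rV[R]_d :=
  xget 0 (\bigcap_(k in [set k | (0 < k)%N])
    (word_map phi n.+1 (mkseq xi k) @` X)).

(* J_n *)
Definition tail_limit_set X I phi (n : nat) : set 'rV[R]_d :=
  coding X phi n @` infwords I n.+1.

Implicit Type beta : nat -> (nat -> T) -> R.

(* S_n beta *)
Definition birkhoff beta (n : nat) (xi : nat -> T) : R :=
  \sum_(1 <= i < n.+1) beta i (iter i.-1 wshift xi).

Definition target_set X I phi beta (xi : nat -> nat -> T) : set 'rV[R]_d :=
  \bigcap_(N in [set N | (0 < N)%N]) \bigcup_(n in [set n | (N <= n)%N])
    \bigcup_(w in words I 1 n)
      eball (word_map phi 1 w (coding X phi n (xi n)))
            (expR (- birkhoff beta n (word_cat w (xi n)))).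

Definition upper_pressure I beta (xi : nat -> nat -> T) (t : R) : \bar R :=
  limn_esup (fun n => (n%:R^-1 *
    ln (\sum_(w \in words I 1 n)
          expR (- (t * birkhoff beta n (word_cat w (xi n))))))%:E).

(* Equal to the sup of the t >= 0 with positive pressure when t |-> P(t) is
   strictly decreasing where finite. *)
Definition bowen I beta (xi : nat -> nat -> T) : \bar R :=
  ereal_inf [set t%:E | t in
    [set t : R | 0 <= t /\ (upper_pressure I beta xi t < 0)%E]].

End ifs.

(* Main.v *)
(* Upper bound: when the pressure at t is negative, the balls B_w with w of
   length at least N form covers whose sums of t-th powers of diameters tend
   to 0.

   Lower bound: let s < t with nonnegative pressure at t. By (7), the cylinders
   of level n have diameter about r_n = kappa_low n, and by (5) and (1) the
   centres of the target balls of level n are r_n-separated. Comparing volumes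
   for the Ahlfors measure, a ball of radius r >= r_n contains at most about
   (r / r_n)^h of them, and this order is attained at every centre once n is
   large. By (4) all target balls of level n may be shrunk to one radius
   R_n <= r_n, and nonnegative pressure says that r_n^h <= C R_n^s' for
   infinitely many n, with s < s' < t. Along a rapidly growing sequence of such
   levels, start from equal weights on the centres of one level, and spread the
   weight of each centre p uniformly over the next-level centres in
   B(p, R_n / 2). The resulting discrete measures satisfy a Frostman bound
   mu(B(y, r)) <= C r^s at all scales above their own, which excludes covers of
   the limsup set with small s-sums. *)
Require Import Defs.
From HB Require Import structures.
From mathcomp Require Import all_boot all_order all_algebra.
From mathcomp Require Import finmap.
From mathcomp Require Import all_classical all_reals all_analysis.
From mathcomp Require Import ring lra.
Import Order.TTheory GRing.Theory Num.Theory.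
Import numFieldNormedType.Exports.
Local Open Scope classical_set_scope.
Local Open Scope ring_scope.
Set Implicit Arguments.
Unset Strict Implicit.
Unset Printing Implicit Defensive.

(** * The Euclidean norm *)

Section EuclideanNorm.
Context {R : realType} {d : nat}.
Implicit Types (x y z u v : 'rV[R]_d) (r : R).

(** The bridge from pressure to geometry is a bound [N_n * r_n^h <= C] on the number [N_n] of words
    of level [n]: each centre lies near a centre of one fixed level, and each of those has at most
    about [r_n^-h] neighbours. Nonnegative pressure at [t] makes [N_n >= exp (s' * sup S_n beta)]
    infinitely often, the gap between [s'] and [t] paying for the variation of [S_n beta]; together
    these give [r_n^h <= C R_n^s']. As [R_n <= r_n] and [r_n] tends to 0, this also forces [s <= h].
    Passing to the next level costs a factor [C^3 R_n^(s-h)] that depends on the level just left.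
    The gap [s' - s] lets a deep enough next level absorb it, so the Frostman constant does not
    deteriorate along the sequence. The maps are differentiable, but no continuity of the derivative
    is assumed. The two geometric inputs, Lipschitz bounds and inner balls of cylinders, therefore
    come from the mean value theorem along segments of the convex set [X] and from a
    minimization. *)

Definition dotv x y : R := \sum_(i < d) x ord0 i * y ord0 i.

Lemma dotvC x y : dotv x y = dotv y x.
Proof. by apply: eq_bigr => i _; rewrite mulrC. Qed.

Lemma dotvDl x y z : dotv (x + y) z = dotv x z + dotv y z.
Proof. by rewrite -big_split; apply: eq_bigr => i _; rewrite mxE mulrDl. Qed.

Lemma dotvZl k x y : dotv (k *: x) y = k * dotv x y.
Proof. by rewrite mulr_sumr; apply: eq_bigr => i _; rewrite mxE mulrA. Qed.

Lemma dotvDr x y z : dotv z (x + y) = dotv z x + dotv z y.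
Proof. by rewrite dotvC dotvDl !(dotvC z). Qed.

Lemma dotvZr k x y : dotv x (k *: y) = k * dotv x y.
Proof. by rewrite dotvC dotvZl dotvC. Qed.

Lemma dotvNr x y : dotv x (- y) = - dotv x y.
Proof. by rewrite -scaleN1r dotvZr mulN1r. Qed.

Lemma dotv_ge0 x : 0 <= dotv x x.
Proof. by apply: sumr_ge0 => i _; rewrite -expr2 sqr_ge0. Qed.

Lemma enorm_ge0 x : 0 <= enorm x. Proof. exact: sqrtr_ge0. Qed.

Lemma sqr_enorm x : enorm x ^+ 2 = dotv x x.
Proof.
rewrite sqr_sqrtr; last by apply: sumr_ge0 => i _; rewrite sqr_ge0.
by apply: eq_bigr => i _; rewrite expr2.
Qed.

Lemma normr_le_enorm x : `|x| <= enorm x.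
Proof.
rewrite [leLHS]/Num.Def.normr/= mx_normrE (bigmax_le _ (enorm_ge0 _))//= => -[i j] _ /=.
rewrite (ord1 i) -sqrtr_sqr ler_wsqrtr// (bigD1 j)//= lerDl.
by apply: sumr_ge0 => k _; rewrite sqr_ge0.
Qed.

Lemma coord_le_normr x i : `|x ord0 i| <= `|x|.
Proof.
rewrite [leRHS]/Num.Def.normr /= mx_normrE; apply/bigmax_geP; right => /=.
by exists (ord0, i).
Qed.

(** The crude constant [d] replaces its square root: the comparison with the sup norm only carries
    over qualitative facts (continuity, boundedness, small remainders). *)
Lemma enorm_le_normr x : enorm x <= d%:R * `|x|.
Proof.
have nn : 0 <= d%:R * `|x| by rewrite mulr_ge0.
rewrite -(ler_pXn2r (n:=2)) ?nnegrE ?enorm_ge0// sqr_enorm.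
apply: (@le_trans _ _ (\sum_(i < d) `|x| ^+ 2)).
  apply: ler_sum => i _; rewrite -expr2 -real_normK ?num_real//.
  by rewrite lerXn2r ?nnegrE// coord_le_normr.
rewrite sumr_const card_ord exprMn -(mulr_natl (`|x| ^+ 2)) ler_wpM2r ?sqr_ge0//.
case: (d) => [|m]; first by rewrite expr0n/=.
by rewrite -natrX ler_nat expnS leq_pmulr// expn_gt0.
Qed.

Lemma enorm0 : enorm (0 : 'rV[R]_d) = 0.
Proof. by rewrite /enorm big1 ?sqrtr0// => i _; rewrite mxE expr0n. Qed.

Lemma enorm_eq0 x : (enorm x == 0) = (x == 0).
Proof.
apply/eqP/eqP => [h|->]; last exact: enorm0.
by apply/eqP; rewrite -normr_le0 (le_trans (normr_le_enorm _))// h.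
Qed.

Lemma enorm_gt0 x : (0 < enorm x) = (x != 0).
Proof. by rewrite lt_def enorm_ge0 andbT enorm_eq0. Qed.

Lemma enormZ k x : enorm (k *: x) = `|k| * enorm x.
Proof.
have [/eqP h|_] := boolP (k == 0); first by rewrite h scale0r normr0 mul0r enorm0.
apply/eqP; rewrite -(eqrXn2 (n:=2)) ?mulr_ge0 ?enorm_ge0//.
by rewrite sqr_enorm dotvZl dotvZr exprMn sqr_enorm mulrA real_normK ?num_real// expr2.
Qed.

Lemma enormN x : enorm (- x) = enorm x.
Proof. by rewrite -scaleN1r enormZ normrN1 mul1r. Qed.

Lemma enormB x y : enorm (x - y) = enorm (y - x).
Proof. by rewrite -enormN opprB. Qed.

Lemma cauchy_schwarz x y : dotv x y <= enorm x * enorm y.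
Proof.
have [->|y0] := eqVneq y 0.
  by rewrite enorm0 mulr0 -(scale0r x) dotvZr mul0r.
have yy : 0 < dotv y y by rewrite -sqr_enorm exprn_gt0// enorm_gt0.
(* The vector is [x] minus its orthogonal projection on [y]. *)
have h := dotv_ge0 (x + (- (dotv x y / dotv y y)) *: y).
have {h} : 0 <= dotv x x - dotv x y ^+ 2 / dotv y y.
  move: h; rewrite dotvDl !dotvDr !dotvZr !dotvZl !(dotvC y x).
  by congr (_ <= _); field; rewrite gt_eqF.
rewrite subr_ge0 ler_pdivrMr// -!sqr_enorm -exprMn => h.
rewrite (le_trans (ler_norm _))// -(ler_pXn2r (n:=2)) ?nnegrE ?mulr_ge0 ?enorm_ge0//.
by rewrite real_normK ?num_real.
Qed.

Lemma enormD x y : enorm (x + y) <= enorm x + enorm y.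
Proof.
rewrite -(ler_pXn2r (n:=2)) ?nnegrE ?addr_ge0 ?enorm_ge0//.
rewrite sqr_enorm dotvDl !dotvDr (dotvC y x) sqrrD -!sqr_enorm.
have := cauchy_schwarz x y; lra.
Qed.

Lemma enorm_triangle y x z : enorm (x - z) <= enorm (x - y) + enorm (y - z).
Proof. by rewrite (le_trans _ (enormD _ _))// addrA subrK. Qed.

Lemma enorm_dist x y : `|enorm x - enorm y| <= enorm (x - y).
Proof.
rewrite ler_norml; have := enormD (x - y) y; have := enormD (y - x) x.
by rewrite !subrK (enormB y x) => ? ?; apply/andP; split; lra.
Qed.

Lemma enormB_continuous (z : 'rV[R]_d) : continuous (fun y => enorm (y - z)).
Proof.
move=> x; apply: (iffRL (@cvgrPdist_lt _ _ _ (nbhs x) (nbhs_filter x) _ _)) => e e0.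
have near_x : \forall y \near x, `|x - y| < (d%:R + 1)^-1 * e.
  apply/nbhs_ballP; exists ((d%:R + 1)^-1 * e) => [/=|y].
    by rewrite mulr_gt0// invr_gt0 ltr_wpDl.
  by rewrite -ball_normE.
near=> y.
rewrite (le_lt_trans (enorm_dist _ _))// opprB addrA subrK.
rewrite (le_lt_trans (enorm_le_normr _))//.
rewrite (@le_lt_trans _ _ ((d%:R + 1) * `|x - y|))//.
  by rewrite ler_wpM2r// lerDl.
rewrite -ltr_pdivlMl; last by rewrite ltr_wpDl.
by near: y; exact: near_x.
Unshelve. all: by end_near. Qed.

Lemma eballxx x r : 0 < r -> eball x r x.
Proof. by rewrite /eball/= subrr enorm0. Qed.

Lemma eball_open x r : open (eball x r).
Proof.
rewrite (_ : eball x r = (fun y => enorm (y - x)) @^-1` [set t | t < r])//.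
by apply: open_comp => [y _|]; [exact: enormB_continuous|exact: open_lt].
Qed.

Definition ecball x r : set 'rV[R]_d := [set y | enorm (y - x) <= r].

Lemma ecball_closed x r : closed (ecball x r).
Proof.
rewrite (_ : ecball x r = (fun y => enorm (y - x)) @^-1` [set t | t <= r])//.
by apply: closed_comp => [y _|]; [exact: enormB_continuous|exact: closed_le].
Qed.

Lemma ecball_compact x r : compact (ecball x r).
Proof.
apply: bounded_closed_compact; last exact: ecball_closed.
exists (`|x| + r); split; first exact: num_real.
move=> M hM y /= yr; rewrite (le_trans _ (ltW hM))//.
rewrite -[y](subrK x) addrC (le_trans (ler_normD _ _))// lerD2l.
exact: le_trans (normr_le_enorm _) yr.
Qed.

Lemma nbhs_eball x r : 0 < r -> nbhs x (eball x r).
Proof. by move=> r0; apply: open_nbhs_nbhs; split; [exact: eball_open|exact: eballxx]. Qed.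

Lemma open_eballP (A : set 'rV[R]_d) x :
  A° x -> exists2 r, 0 < r & eball x r `<=` A.
Proof.
rewrite /interior => /nbhs_ballP[r /= r0 rA]; exists r => // y yr; apply: rA.
by rewrite -ball_normE /ball_/= distrC (le_lt_trans (normr_le_enorm _)).
Qed.

Lemma compact_enorm_bounded (A : set 'rV[R]_d) : compact A ->
  exists2 D, 0 < D & forall x y, A x -> A y -> enorm (x - y) <= D.
Proof.
move=> /compact_bounded[M [_ hM]].
pose M' := `|M| + 1.
have MM' : M < M' by rewrite (le_lt_trans (ler_norm _))// ltrDl.
exists (d%:R * (M' + M') + 1) => [|x y Ax Ay].
  by rewrite ltr_wpDl// mulr_ge0// addr_ge0// /M' addr_ge0.
rewrite (le_trans (enorm_le_normr _))// (@le_trans _ _ (d%:R * (M' + M')))//.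
  rewrite ler_wpM2l// (le_trans (ler_normB _ _))//.
  by rewrite lerD// (hM M').
by rewrite lerDl.
Qed.

(** Points chosen in the [K n] have a cluster point, which lies in each closed [K n] because the
    sequence is eventually inside it. *)
Lemma nested_compact (K : nat -> set 'rV[R]_d) :
  (forall n, compact (K n)) -> (forall n, K n !=set0) ->
  (forall n, K n.+1 `<=` K n) -> \bigcap_n K n !=set0.
Proof.
move=> cK K0 decr.
have le_K m n : (m <= n)%N -> K n `<=` K m.
  elim: n => [|n ih]; first by rewrite leqn0 => /eqP ->.
  rewrite leq_eqVlt => /orP[/eqP ->//|]; rewrite ltnS => /ih h.
  by apply: subset_trans (decr n) h.
pose x n := projT1 (cid (K0 n)).
have xK n : K n (x n) by rewrite /x; case: cid.
have /(cK 0%N)[p [K0p clp]] : (x @ \oo) (K 0%N).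
  by exists 0%N => // n _ /=; exact: (le_K 0%N n).
exists p => n _.
have cl : closed (K n) by apply: compact_closed => //; exact: norm_hausdorff.
apply: cl => B Bp; apply: clp => //.
by exists n => // m /= nm; exact: le_K nm _ (xK m).
Qed.

End EuclideanNorm.

(** * The mass distribution principle *)

Section MassDistribution.
Context {R : realType} {d : nat}.
Implicit Types (A D U : set 'rV[R]_d).

Lemma ediam_ge0 U u : U u -> (0 <= ediam U)%E.
Proof. by move=> Uu; apply: ereal_sup_ubound; exists (u, u) => //=; rewrite subrr enorm0. Qed.

Lemma diam_pow_ge0 (s : R) U : (0 <= diam_pow s U)%E.
Proof. by rewrite /diam_pow; case: ifP => // _; exact: poweR_ge0. Qed.

(** Turns a covering set into an open ball at the price [e]. Raising the exponent from [s0] to [s]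
    is legitimate because diameters are at most 1, and it makes the exponent positive even when
    [s0 = 0]. The slack makes the radius [(r^s + e)^(1/s)] exceed the diameter [r], also for a
    singleton. *)
Lemma diam_pow_lt_eball (s0 s e : R) U : 0 <= s0 -> s0 < s -> 0 < e ->
  (ediam U <= 1%:E)%E ->
  exists u delta, [/\ 0 < delta, U `<=` eball u delta &
    ((delta `^ s)%:E <= diam_pow s0 U + e%:E)%E].
Proof.
move=> s00 s0s e0 U1; have s_gt0 : 0 < s by apply: le_lt_trans s0s.
have [->|/set0P[u Uu]] := eqVneq U set0.
  exists 0, (e `^ s^-1); split; [exact: powR_gt0|exact: sub0set|].
  by rewrite -powRrM mulVf ?gt_eqF// powRr1 ?(ltW e0)// /diam_pow eqxx add0e.
have U0 := ediam_ge0 Uu.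
have [r rE] : exists r, ediam U = r%:E.
  by exists (fine (ediam U)); rewrite fineK// ge0_fin_numE// (le_lt_trans U1)// ltry.
have r0 : 0 <= r by rewrite -lee_fin -rE.
have r1 : r <= 1 by rewrite -lee_fin -rE.
have dE : diam_pow s0 U = (r `^ s0)%:E.
  rewrite /diam_pow ifF ?rE ?poweR_EFin//.
  by apply/negbTE; apply/set0P; exists u.
have re0 : 0 < r `^ s + e by rewrite ltr_wpDl ?powR_ge0.
exists u, ((r `^ s + e) `^ s^-1); split; first exact: powR_gt0.
  move=> v Uv; rewrite /eball/=.
  have vr : enorm (v - u) <= r.
    by rewrite -lee_fin -rE; apply: ereal_sup_ubound; exists (v, u).
  rewrite (le_lt_trans vr)//.
  have -> : r = (r `^ s) `^ s^-1 by rewrite -powRrM mulfV ?gt_eqF// powRr1.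
  rewrite -[in ltRHS](powRrM r) mulfV ?gt_eqF// powRr1//.
  by apply: gt0_ltr_powR; rewrite ?invr_gt0 ?nnegrE ?powR_ge0 ?ltW// ltrDl.
rewrite -powRrM mulVf ?gt_eqF// powRr1 ?(ltW re0)// dE -EFinD lee_fin lerD2r.
have [->|rn0] := eqVneq r 0; first by rewrite (powR0 (lt0r_neq0 s_gt0)) powR_ge0.
by apply: ger_powR (ltW s0s); rewrite lt_def rn0 r0 r1.
Qed.

Lemma sum_geo_half (e : R) k : 0 <= e -> \sum_(i < k) e / 2 ^+ i.+1 <= e.
Proof.
move=> e0; suff -> : \sum_(i < k) e / 2 ^+ i.+1 = e - e / 2 ^+ k.
  by rewrite gerBl divr_ge0// exprn_ge0.
elim: k => [|k ih]; first by rewrite big_ord0 expr0 divr1 subrr.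
rewrite big_ord_recr/= ih exprS; field.
by rewrite expf_neq0.
Qed.

(* A discrete Frostman lemma: the weights [w J] play the role of a measure on
   the limit set, which never has to be constructed. *)
Lemma hausdorff_measure_neq0 (D : set 'rV[R]_d) (s0 s C : R)
    (L : nat -> seq 'rV[R]_d) (w : nat -> 'rV[R]_d -> R) (K : nat -> set 'rV[R]_d) :
  0 <= s0 -> s0 < s -> 0 < C ->
  (forall J p, 0 <= w J p) -> (forall J, \sum_(p <- L J) w J p = 1) ->
  (forall delta, 0 < delta -> exists J0, forall J y, (J0 <= J)%N ->
    \sum_(p <- L J | enorm (p - y) < delta) w J p <= C * delta `^ s) ->
  (forall j, compact (K j)) ->
  (forall j J p, (j <= J)%N -> p \in L J -> 0 < w J p -> K j p) ->
  \bigcap_j K j `<=` D -> hausdorff_measure s0 D <> 0%E.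
Proof.
move=> s00 s0s C0 w0 w1 wC Kc LK KD H0.
(* The covering balls will carry mass at most [C * (eta + eta) = 1/2], less than the total mass 1:
   one [eta] bounds the content, the other pays for turning sets into balls. *)
pose eta := (4 * C)^-1.
have eta0 : 0 < eta by rewrite invr_gt0 mulr_gt0.
have : (hausdorff_content s0 1 D < eta%:E)%E.
  rewrite (@le_lt_trans _ _ 0%E) ?lte_fin// -H0.
  by apply: ereal_sup_ubound; exists 1 => //=.
move=> /ereal_inf_lt[_ [U [U1 DU] <-] Ueta].
have /choice[f fP] : forall i, exists ud : 'rV[R]_d * R, [/\ 0 < ud.2,
    U i `<=` eball ud.1 ud.2 &
    ((ud.2 `^ s)%:E <= diam_pow s0 (U i) + (eta / 2 ^+ i.+1)%:E)%E].
  move=> i; have e0 : 0 < eta / 2 ^+ i.+1 by rewrite divr_gt0// exprn_gt0.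
  by have [u [dl h]] := diam_pow_lt_eball s00 s0s e0 (U1 i); exists (u, dl).
have sum_f k : \sum_(i < k) (f i).2 `^ s <= eta + eta.
  rewrite -lee_fin -sumEFin.
  apply: (@le_trans _ _ (\sum_(i < k) (diam_pow s0 (U i) + (eta / 2 ^+ i.+1)%:E))%E).
    by apply: lee_sum => i _; have [] := fP i.
  rewrite big_split/= EFinD leeD//; last by rewrite sumEFin lee_fin sum_geo_half// ltW.
  apply: le_trans (ltW Ueta).
  rewrite -(big_mkord xpredT (fun i => diam_pow s0 (U i))).
  by apply: nneseries_lim_ge => i _ _; exact: diam_pow_ge0.
have /choice[g gP] : forall i, exists J0, forall J y, (J0 <= J)%N ->
    \sum_(p <- L J | enorm (p - y) < (f i).2) w J p <= C * (f i).2 `^ s.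
  by move=> i; apply: wC; have [] := fP i.
(* The first [k] balls cannot carry all the mass of a level [J] beyond [k] and beyond their [k]
   thresholds, so some point of positive weight escapes them. *)
have /choice[x xP] : forall k, exists p, (exists J, [/\ (k <= J)%N, p \in L J & 0 < w J p])
    /\ forall i, (i < k)%N -> ~ eball (f i).1 (f i).2 p.
  move=> k; pose J := maxn k (\max_(i < k) g i).
  have [//|no] := pselect (exists p, [/\ p \in L J, 0 < w J p &
     forall i, (i < k)%N -> ~ eball (f i).1 (f i).2 p]).
    by move=> [p [pJ wp h]]; exists p; split => //; exists J; split => //; exact: leq_maxl.
  exfalso.
  have : 1 <= C * (eta + eta).
    rewrite -(w1 J); apply: (@le_trans _ _ (\sum_(p <- L J) \sum_(i < k)
       (if enorm (p - (f i).1) < (f i).2 then w J p else 0))).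
      rewrite big_seq [leRHS]big_seq; apply: ler_sum => p pJ.
      have ge0 (i : 'I_k) : 0 <= (if enorm (p - (f i).1) < (f i).2 then w J p else 0).
        by case: ifP.
      have [wp|] := ltP 0 (w J p); last first.
        by move=> wp; apply: le_trans wp _; apply: sumr_ge0.
      have [[i [ik pi]]|h] := pselect (exists i, (i < k)%N /\ eball (f i).1 (f i).2 p).
        rewrite (bigD1 (Ordinal ik))//= ifT// lerDl; exact: sumr_ge0.
      by case: no; exists p; split => // i ik pi; apply: h; exists i.
    rewrite exchange_big/=.
    apply: (@le_trans _ _ (\sum_(i < k) C * (f i).2 `^ s)).
      apply: ler_sum => i _; rewrite -big_mkcond; apply: gP.
      by rewrite leq_max (leq_bigmax i) orbT.
    by rewrite -mulr_sumr ler_wpM2l// ltW.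
  have -> : C * (eta + eta) = 2^-1 by rewrite /eta; field; rewrite gt_eqF.
  lra.
have xK j k : (j <= k)%N -> K j (x k).
  by move=> jk; have [[J [kJ xJ wJ]] _] := xP k; apply: LK xJ wJ; exact: leq_trans jk kJ.
(* A cluster point of the escaping points lies in every [K j], hence in some covering ball; but it
   also lies in the closed complement of each of these balls. *)
have /(Kc 0%N)[p [_ clp]] : (x @ \oo) (K 0%N) by exists 0%N => // n _; exact: xK.
have pK j : K j p.
  have cl : closed (K j) by apply: compact_closed => //; exact: norm_hausdorff.
  by apply: cl => B Bp; apply: clp => //; exists j => // m /= jm; exact: xK.
have [i _ Uip] : (\bigcup_i U i) p by apply: DU; apply: KD => j _; exact: pK.
have pi : eball (f i).1 (f i).2 p by have [_ h _] := fP i; exact: h.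
have [q [qn]] : (~` eball (f i).1 (f i).2) `&` eball (f i).1 (f i).2 !=set0.
  apply: clp; last by apply: open_nbhs_nbhs; split => //; exact: eball_open.
  by exists i.+1 => // m /= im; have [_ h] := xP m; exact: h.
by move=> /qn.
Qed.

End MassDistribution.

(** * Hausdorff measure of limsup sets of balls *)

Lemma powR_div (R : realType) (a b x : R) : 0 <= a -> 0 <= b ->
  (a / b) `^ x = a `^ x / b `^ x.
Proof.
move=> a0 b0; rewrite powRM ?invr_ge0// -[in LHS](powR_inv1 b0) powRAC.
by rewrite powR_inv1 ?powR_ge0.
Qed.

Lemma powR_expR (R : realType) (a t : R) : expR a `^ t = expR (t * a).
Proof. by rewrite /powR gt_eqF ?expR_gt0// expRK. Qed.

Lemma powR_small (R : realType) (c t : R) : 0 < c -> 0 < t ->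
  exists2 e, 0 < e & forall x, 0 <= x -> x <= e -> c * x `^ t <= 1.
Proof.
move=> c0 t0; exists (c^-1 `^ t^-1) => [|x x0 xe]; first by rewrite powR_gt0// invr_gt0.
rewrite -ler_pdivlMl// mulr1.
have -> : c^-1 = (c^-1 `^ t^-1) `^ t by rewrite -powRrM mulVf ?gt_eqF// powRr1// invr_ge0 ltW.
by apply: ge0_ler_powR; rewrite ?nnegrE ?powR_ge0// ltW.
Qed.

Section LimsupBalls.
Context {R : realType} {d : nat}.
Variables (P : nat -> seq 'rV[R]_d) (rad sep : nat -> R) (h C : R).
Implicit Types (p q : 'rV[R]_d) (n : nat).

Definition near_count n (y : 'rV[R]_d) (r : R) : R := (count (fun p => enorm (p - y) < r) (P n))%:R.

Hypothesis h0 : 0 <= h.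
Hypothesis C1 : 1 <= C.
Hypothesis rad_gt0 : forall n, (0 < n)%N -> 0 < rad n.
Hypothesis rad_le_sep : forall n, (0 < n)%N -> rad n <= sep n.
Hypothesis count_le : forall n y r, (0 < n)%N -> sep n <= r -> r <= 3^-1 ->
  near_count n y r <= C * (r / sep n) `^ h.
Hypothesis count_ge : forall n p, (0 < n)%N -> p \in P n -> rad n <= 1 ->
  exists N, forall m, (N <= m)%N ->
    C^-1 * (rad n / sep m) `^ h <= near_count m p (rad n / 2).

Let C0 : 0 < C. Proof. exact: lt_le_trans C1. Qed.

Let sep_gt0 n : (0 < n)%N -> 0 < sep n.
Proof. by move=> n0; apply: lt_le_trans (rad_le_sep n0); exact: rad_gt0. Qed.

(** The threshold in [count_ge] depends on the centre; a maximum over the finite list [P n] removes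
    this. *)
Lemma count_ge_unif n : (0 < n)%N -> rad n <= 1 ->
  exists N, forall m p, (N <= m)%N -> p \in P n ->
    C^-1 * (rad n / sep m) `^ h <= near_count m p (rad n / 2).
Proof.
move=> n0 n1.
suff: forall l : seq _, {subset l <= P n} -> exists N, forall m p, (N <= m)%N -> p \in l ->
    C^-1 * (rad n / sep m) `^ h <= near_count m p (rad n / 2) by apply.
elim=> [|a l ih] lP; first by exists 0%N.
have [|N1 hN1] := ih; first by move=> p pl; apply: lP; rewrite inE pl orbT.
have [|N2 hN2] := count_ge n0 _ n1 (p := a); first by apply: lP; rewrite mem_head.
exists (maxn N1 N2) => m p; rewrite geq_max => /andP[m1 m2].
by rewrite inE => /orP[/eqP ->|pl]; [exact: hN2|exact: hN1].
Qed.

Lemma sum_count (n : nat) (Q : pred 'rV[R]_d) (c : R) :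
  \sum_(q <- P n | Q q) c = c * (count Q (P n))%:R.
Proof. by rewrite big_const_seq iter_addr_0 mulr_natr. Qed.

(** * One step of the construction: from level [n] to level [m] *)

Section Step.
Variables (s s' A : R) (n m : nat) (w : 'rV[R]_d -> R).
Hypotheses (s0 : 0 <= s) (sh : s <= h) (A0 : 0 <= A).
Hypotheses (n0 : (0 < n)%N) (m0 : (0 < m)%N).
Hypotheses (sepn : sep n <= 3^-1) (sepm3 : sep m <= 3^-1) (w_ge0 : forall p, 0 <= w p).
Hypothesis w_le : forall p, p \in P n -> w p <= A * rad n `^ s.
Hypothesis count_m : forall p, p \in P n ->
  C^-1 * (rad n / sep m) `^ h <= near_count m p (rad n / 2).
Hypothesis sepm_rad : sep m `^ h <= C * rad m `^ s'.
Hypothesis rad_small : C ^+ 3 * (rad n `^ s / rad n `^ h) * rad m `^ s' <= rad m `^ s.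

(** The total weight that [q] receives. The half radius, combined with [rad m <= rad n / 4] at every
    step, keeps all later displacements of mass within [rad n]. *)
Definition spread (q : 'rV[R]_d) : R :=
  \sum_(p <- P n | enorm (q - p) < rad n / 2) w p / near_count m p (rad n / 2).

Let radn : 0 < rad n. Proof. exact: rad_gt0. Qed.
Let radm : 0 < rad m. Proof. exact: rad_gt0. Qed.
Let sepm : 0 < sep m. Proof. exact: sep_gt0. Qed.

Let count_gt0 p : p \in P n -> 0 < near_count m p (rad n / 2).
Proof.
move=> pP; apply: lt_le_trans (count_m pP).
by rewrite mulr_gt0 ?invr_gt0// powR_gt0// divr_gt0.
Qed.

Lemma spread_ge0 q : 0 <= spread q.
Proof. by apply: sumr_ge0 => p _; rewrite divr_ge0// /near_count ler0n. Qed.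

Lemma spread_gt0 q : 0 < spread q ->
  exists p, [/\ p \in P n, 0 < w p & enorm (q - p) < rad n / 2].
Proof.
move=> s_gt0; apply: contrapT => no; move: s_gt0.
rewrite /spread big_seq_cond big1 ?ltxx// => p /andP[pP qp].
have [wp|] := ltP 0 (w p); first by case: no; exists p.
by move=> wp; rewrite (_ : w p = 0) ?mul0r//; apply/eqP; rewrite eq_le wp w_ge0.
Qed.

Lemma spread_mass (p : 'rV[R]_d) : p \in P n ->
  \sum_(q <- P m | enorm (q - p) < rad n / 2) w p / near_count m p (rad n / 2) = w p.
Proof.
by move=> pP; rewrite sum_count -/(near_count _ _ _) mulfVK// gt_eqF// count_gt0.
Qed.

Lemma spread_total : \sum_(q <- P m) spread q = \sum_(p <- P n) w p.
Proof.
rewrite (exchange_big_dep xpredT)//= big_seq [RHS]big_seq.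
by apply: eq_bigr => p; exact: spread_mass.
Qed.

(** Mass travels less than [rad n / 2], so what level [m] has in a ball came from centres of level
    [n] in the enlarged ball. *)
Lemma spread_flow y (r : R) :
  \sum_(q <- P m | enorm (q - y) < r) spread q <=
  \sum_(p <- P n | enorm (p - y) < r + rad n / 2) w p.
Proof.
rewrite (exchange_big_dep (fun p => enorm (p - y) < r + rad n / 2))/=; last first.
  move=> q p qy qp; rewrite (le_lt_trans (enorm_triangle q _ _))//.
  by rewrite addrC ltrD// enormB.
rewrite big_seq_cond [leRHS]big_seq_cond; apply: ler_sum => p /andP[pP _].
rewrite -[leRHS]spread_mass// big_mkcondl/=; apply: ler_sum => q _.
by case: ifP => // _; rewrite divr_ge0// /near_count ler0n.
Qed.

(** At most [C] centres contribute to [q], by [count_le] at radius [sep n], which exceeds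
    [rad n / 2]. Each of them gives at most [A * rad n ^ s] divided by the lower count
    [C^-1 * (rad n / sep m) ^ h]. *)
Lemma spread_le q : spread q <= A * C ^+ 2 * (rad n `^ s * (sep m / rad n) `^ h).
Proof.
rewrite /spread.
apply: (@le_trans _ _ (\sum_(p <- P n | enorm (q - p) < rad n / 2)
   (A * C * (rad n `^ s * (sep m / rad n) `^ h)))).
  rewrite big_seq_cond [leRHS]big_seq_cond; apply: ler_sum => p /andP[pP _].
  rewrite ler_pdivrMr ?count_gt0//; apply: le_trans (w_le pP) _.
  have -> : A * rad n `^ s = A * C * (rad n `^ s * (sep m / rad n) `^ h) *
      (C^-1 * (rad n / sep m) `^ h).
    have e1 : (sep m / rad n) `^ h * (rad n / sep m) `^ h = 1.
      rewrite -powRM ?divr_ge0 ?(ltW sepm) ?(ltW radn)//.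
      by rewrite (_ : _ * _ = 1) ?powR1//; field; rewrite !gt_eqF.
    have -> : A * C * (rad n `^ s * (sep m / rad n) `^ h) * (C^-1 * (rad n / sep m) `^ h) =
      A * rad n `^ s * (C * C^-1) * ((sep m / rad n) `^ h * (rad n / sep m) `^ h) by ring.
    by rewrite e1 mulfV ?gt_eqF// !mulr1.
  rewrite ler_wpM2l ?count_m//.
  by rewrite !mulr_ge0 ?powR_ge0// ltW.
rewrite sum_count.
have -> : A * C ^+ 2 * (rad n `^ s * (sep m / rad n) `^ h) =
  A * C * (rad n `^ s * (sep m / rad n) `^ h) * C by ring.
rewrite ler_wpM2l//.
  by rewrite !mulr_ge0 ?powR_ge0// ltW.
have := count_le q n0 (lexx (sep n)) sepn.
rewrite mulfV ?gt_eqF ?sep_gt0// powR1 mulr1; apply: le_trans.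
rewrite /near_count ler_nat; apply: sub_count => p /=.
rewrite enormB => /lt_le_trans; apply; apply: le_trans (rad_le_sep n0).
by rewrite ler_pdivrMr// mulr2n mulrDr mulr1 lerDl ltW.
Qed.

(** The same [A] survives the step: [sepm_rad] trades [sep m ^ h] for [rad m ^ s'], and [rad_small]
    then absorbs all constants of level [n]. *)
Lemma spread_le_rad q : spread q <= A * rad m `^ s.
Proof.
apply: le_trans (spread_le q) _; rewrite -mulrA ler_wpM2l//.
apply: le_trans rad_small; rewrite powR_div ?(ltW sepm) ?(ltW radn)//.
have -> : C ^+ 3 * (rad n `^ s / rad n `^ h) * rad m `^ s' =
  C ^+ 2 * (rad n `^ s / rad n `^ h) * (C * rad m `^ s') by ring.
rewrite (_ : C ^+ 2 * _ = C ^+ 2 * (rad n `^ s / rad n `^ h) * sep m `^ h); last by ring.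
by rewrite ler_wpM2l// mulr_ge0 ?exprn_ge0 ?(ltW C0)// divr_ge0 ?powR_ge0.
Qed.

(** The Frostman bound between two consecutive radii. If [2 * r >= sep m], the number of centres
    times the largest weight is of order [rad n ^ s * (r / rad n) ^ h], and [s <= h] with
    [r < rad n] lowers the exponent to [s]. If [2 * r < sep m], at most [C] centres are involved,
    each of weight at most [A * rad m ^ s <= A * r ^ s]. The doubled radius leaves room for the
    displacement caused by later levels. *)
Lemma spread_ball y r : rad m <= r -> r < rad n -> rad n <= 6^-1 ->
  \sum_(q <- P m | enorm (q - y) < 2 * r) spread q <= A * C ^+ 3 * 2 `^ h * r `^ s.
Proof.
move=> mr rn rn6; have r0 : 0 < r by exact: lt_le_trans mr.
have C_ge1 k : 1 <= C ^+ k by rewrite exprn_ege1.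
have [sr|rs] := leP (sep m) (2 * r).
  apply: (@le_trans _ _ (\sum_(q <- P m | enorm (q - y) < 2 * r)
     (A * C ^+ 2 * (rad n `^ s * (sep m / rad n) `^ h)))).
    by apply: ler_sum => q _; exact: spread_le.
  rewrite sum_count; apply: (@le_trans _ _
    (A * C ^+ 2 * (rad n `^ s * (sep m / rad n) `^ h) * (C * (2 * r / sep m) `^ h))).
    rewrite ler_wpM2l//.
      by rewrite !mulr_ge0 ?powR_ge0// ?exprn_ge0 ?(ltW C0).
    by apply: count_le => //; lra.
  have -> : A * C ^+ 2 * (rad n `^ s * (sep m / rad n) `^ h) * (C * (2 * r / sep m) `^ h) =
    A * C ^+ 3 * (rad n `^ s * ((sep m / rad n) `^ h * (2 * r / sep m) `^ h)) by ring.
  rewrite -powRM ?divr_ge0 ?mulr_ge0 ?(ltW sepm) ?(ltW radn) ?(ltW r0)//.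
  have -> : sep m / rad n * (2 * r / sep m) = 2 * (r / rad n).
    by field; rewrite !gt_eqF.
  rewrite powRM ?divr_ge0 ?(ltW radn) ?(ltW r0)//.
  rewrite -[leRHS]mulrA ler_wpM2l ?mulr_ge0 ?exprn_ge0 ?(ltW C0)//.
  rewrite mulrCA ler_wpM2l ?powR_ge0//.
  apply: (@le_trans _ _ (rad n `^ s * (r / rad n) `^ s)).
    rewrite ler_wpM2l ?powR_ge0//; apply: ger_powR => //.
    by rewrite divr_gt0//= ler_pdivrMr// mul1r ltW.
  rewrite -powRM ?divr_ge0 ?(ltW radn) ?(ltW r0)//.
  by rewrite mulrC mulfVK ?gt_eqF.
apply: (@le_trans _ _ (\sum_(q <- P m | enorm (q - y) < 2 * r) (A * r `^ s))).
  apply: ler_sum => q _; apply: le_trans (spread_le_rad q) _.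
  by rewrite ler_wpM2l// ge0_ler_powR// nnegrE ltW.
rewrite sum_count.
have -> : A * C ^+ 3 * 2 `^ h * r `^ s = A * r `^ s * (C ^+ 3 * 2 `^ h) by ring.
rewrite ler_wpM2l ?mulr_ge0 ?powR_ge0//.
apply: (@le_trans _ _ C); last first.
  rewrite (exprSr C 2) mulrC mulrA ler_peMl ?(ltW C0)//.
  have le2h : 1 <= 2 `^ h :> R by rewrite -[leLHS](powRr0 2) ler_powR// ler1n.
  by rewrite mulr_ege1// exprn_ege1.
have := count_le y m0 (lexx (sep m)) sepm3.
rewrite mulfV ?gt_eqF// powR1 mulr1; apply: le_trans.
by rewrite /near_count ler_nat; apply: sub_count => p /= /lt_trans; apply.
Qed.

End Step.

(** * The sequence of levels *)

Section Construction.
Variables (s s' A : R).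
Hypotheses (s_ge0 : 0 <= s) (ss' : s < s') (sh : s <= h) (A0 : 0 <= A).
Hypothesis sep_small : forall e, 0 < e -> exists N, forall n, (N <= n)%N -> sep n < e.
Hypothesis sep_rad : forall N, exists n, (N <= n)%N /\ sep n `^ h <= C * rad n `^ s'.

(** A state of the construction is a pair of a level and weights on its centres. The bound [6^-1]
    makes the radii [2 * r] with [r < rad x.1] admissible in [count_le]. *)
Definition weights_ok (x : nat * ('rV[R]_d -> R)) := [/\ (0 < x.1)%N, sep x.1 <= 6^-1,
  forall p, 0 <= x.2 p, \sum_(p <- P x.1) x.2 p = 1 &
  forall p, p \in P x.1 -> x.2 p <= A * rad x.1 `^ s].

Definition refines (B : R) (x y : nat * ('rV[R]_d -> R)) := [/\ (x.1 < y.1)%N,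
  rad y.1 <= rad x.1 / 4,
  forall z r, \sum_(q <- P y.1 | enorm (q - z) < r) y.2 q <=
    \sum_(p <- P x.1 | enorm (p - z) < r + rad x.1 / 2) x.2 p,
  forall q, 0 < y.2 q ->
    exists p, [/\ p \in P x.1, 0 < x.2 p & enorm (q - p) < rad x.1 / 2] &
  forall z r, rad y.1 <= r -> r < rad x.1 ->
    \sum_(q <- P y.1 | enorm (q - z) < 2 * r) y.2 q <= B * r `^ s].

(** The next level [m] has to be deep: beyond [N1] the lower counts hold around all centres of level
    [n]; beyond [N2] its radius is below [rad n / 4] and small enough for the gap [s' - s] to absorb
    the constant [c] of level [n]. Since [sep_rad] holds infinitely often, such an [m] exists. *)
Lemma refinement x : weights_ok x ->
  exists y, weights_ok y /\ refines (A * C ^+ 3 * 2 `^ h) x y.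
Proof.
move: x => [n w] [/= n0 sepn w0 w1 wA].
have rn0 := rad_gt0 n0; have rn1 : rad n <= 1.
  by apply: le_trans (rad_le_sep n0) _; apply: le_trans sepn _; lra.
have [N1 hN1] := count_ge_unif n0 rn1.
pose c := C ^+ 3 * (rad n `^ s / rad n `^ h).
have c0 : 0 < c by rewrite mulr_gt0 ?exprn_gt0// divr_gt0// powR_gt0.
have t0 : 0 < s' - s by rewrite subr_gt0.
have [e e0 he] := powR_small c0 t0.
have [|N2 hN2] := sep_small (e := Num.min (Num.min e 6^-1) (rad n / 4)).
  by rewrite !lt_min e0 divr_gt0// andbT/=; lra.
have [m [mN sepm]] := sep_rad (maxn (maxn N1 N2) n.+1).
move: mN; rewrite !geq_max => /andP[/andP[mN1 mN2] nm].
have m0 : (0 < m)%N by apply: leq_trans nm.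
have rm0 := rad_gt0 m0; have rm := rad_le_sep m0.
have := hN2 m mN2; rewrite !lt_min => /andP[/andP[sepe sep6] sepr].
have sep3 : sep m <= 3^-1 by lra.
have sepn3 : sep n <= 3^-1 by lra.
have cm : forall p, p \in P n -> C^-1 * (rad n / sep m) `^ h <= near_count m p (rad n / 2).
  by move=> p; exact: hN1.
have small : C ^+ 3 * (rad n `^ s / rad n `^ h) * rad m `^ s' <= rad m `^ s.
  rewrite -/c (_ : s' = (s' - s) + s); last by rewrite subrK.
  rewrite powRD; last by rewrite (gt_eqF rm0) implybT.
  rewrite mulrA ler_piMl ?powR_ge0//; apply: he; first exact: ltW.
  by apply: le_trans rm _; exact: ltW.
exists (m, spread n m w); split; split => //=.
- exact: ltW.
- by move=> p; exact: spread_ge0.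
- by rewrite spread_total.
- by move=> p _; exact: (spread_le_rad (s' := s')).
- by apply: le_trans rm _; exact: ltW.
- by move=> z r; exact: spread_flow.
- by move=> q; exact: spread_gt0.
- move=> z r mr rn; apply: (spread_ball (s' := s')) => //.
  exact: le_trans (rad_le_sep n0) sepn.
Qed.

End Construction.

Theorem limsup_balls_hausdorff (D : set 'rV[R]_d) (s0 s s' : R) :
  0 <= s0 -> s0 < s -> s < s' -> s <= h ->
  (forall e, 0 < e -> exists N, forall n, (N <= n)%N -> sep n < e) ->
  (forall N, exists n, (N <= n)%N /\ sep n `^ h <= C * rad n `^ s') ->
  (forall n, (0 < n)%N -> P n != [::]) ->
  (forall x, (forall N, exists n p, [/\ (N <= n)%N, p \in P n & enorm (x - p) <= rad n]) -> D x) ->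
  hausdorff_measure s0 D <> 0%E.
Proof.
move=> s00 s0s ss' sh sep_small sep_rad Pn0 DP.
have s_ge0 : 0 <= s by rewrite ltW// (le_lt_trans s00).
have [|N hN] := sep_small 6^-1; first by lra.
pose n0 := N.+1; have n00 : (0 < n0)%N by [].
have r00 := rad_gt0 n00.
(* Chosen so that [A * rad n0 ^ s = 1], which dominates the equal initial weights. *)
pose A := (rad n0 `^ s)^-1.
have A0 : 0 <= A by rewrite invr_ge0 powR_ge0.
pose B := A * C ^+ 3 * 2 `^ h.
pose w0 (p : 'rV[R]_d) := ((size (P n0))%:R : R)^-1.
have szP : (0 < size (P n0))%N by rewrite lt0n size_eq0 Pn0.
have Px : weights_ok s A (n0, w0).
  split => //=.
  - by rewrite ltW// hN// leqnSn.
  - by move=> p; rewrite invr_ge0.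
  - by rewrite sum_count count_predT mulVf// pnatr_eq0 -lt0n.
  - move=> p _; rewrite mulVf ?gt_eqF ?powR_gt0// /w0 invf_le1 ?ltr0n//.
    by rewrite ler1n.
have [f [f0 fR]] : exists f : nat -> {x | weights_ok s A x},
   f 0%N = exist _ _ Px /\ forall j, refines s B (sval (f j)) (sval (f j.+1)).
  have step (x : {x | weights_ok s A x}) :
      {y : {y | weights_ok s A y} | refines s B (sval x) (sval y)}; last first.
    by have [g [g0 gR]] := dependent_choice step (exist _ _ Px); exists g.
  case: x => x xP /=; apply: cid.
  have [y [yP xy]] := refinement s_ge0 ss' sh A0 sep_small sep_rad xP.
  by exists (exist _ y yP).
pose n j := (sval (f j)).1; pose w j := (sval (f j)).2.
have n_gt0 j : (0 < n j)%N by have [] := svalP (f j).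
have w_ge0 j p : 0 <= w j p by have [_ _ h1 _ _] := svalP (f j); exact: h1.
have w_sum j : \sum_(p <- P (n j)) w j p = 1 by have [_ _ _ h1 _] := svalP (f j); exact: h1.
have n_ge j : (j <= n j)%N.
  elim: j => // j ih; apply: leq_ltn_trans ih _; by have [] := fR j.
pose rho j := rad (n j).
have rho_gt0 j : 0 < rho j by exact: rad_gt0.
have rhoS j : rho j.+1 <= rho j / 4 by have [] := fR j.
have rho0 : rho 0%N = rad n0 by rewrite /rho /n f0.
(* Displacements telescope: one step moves mass by less than [rho J / 2], which is at most
   [rho J - rho J.+1]. *)
have trace j J p : (j <= J)%N -> p \in P (n J) -> 0 < w J p ->
    exists q, [/\ q \in P (n j), 0 < w j q & enorm (p - q) <= rho j - rho J].
  elim: J p => [|J ih] p; first by rewrite leqn0 => /eqP -> pP wp; exists p; rewrite !subrr enorm0.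
  rewrite leq_eqVlt => /orP[/eqP -> pP wp|]; first by exists p; rewrite !subrr enorm0.
  rewrite ltnS => jJ pP wp; have [_ _ _ hpos _] := fR J.
  have [p' [p'P wp' pp']] := hpos p wp.
  have [q [qP wq p'q]] := ih p' jJ p'P wp'.
  exists q; split => //; have := enorm_triangle p' p q; have := rhoS J; have := rho_gt0 J.
  by move: pp'; rewrite -/(n J) -/(rho J); lra.
have flow j J y r : (j <= J)%N -> \sum_(p <- P (n J) | enorm (p - y) < r) w J p <=
    \sum_(q <- P (n j) | enorm (q - y) < r + (rho j - rho J)) w j q.
  elim: J r => [|J ih] r; first by rewrite leqn0 => /eqP ->; rewrite subrr addr0.
  rewrite leq_eqVlt => /orP[/eqP ->|]; first by rewrite subrr addr0.
  rewrite ltnS => jJ; have [_ _ hflow _ _] := fR J.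
  apply: le_trans (hflow y r) _; apply: le_trans (ih _ jJ) _.
  rewrite big_mkcond [leRHS]big_mkcond; apply: ler_sum => q _.
  have := rhoS J; have := rho_gt0 J; rewrite -/(n J) -/(rho J) => h1 h2.
  case: ifPn => h3; last by case: ifPn.
  by rewrite ifT//; apply: lt_le_trans h3 _; lra.
pose K j : set 'rV[R]_d := [set x | exists q, [/\ q \in P (n j), 0 < w j q & ecball q (rho j) x]].
have B0 : 0 <= B by rewrite !mulr_ge0 ?exprn_ge0 ?powR_ge0 ?(ltW C0).
(* In the Frostman constant, [B] serves the radii below [rho 0], [A] the larger ones, where the
   total mass 1 is at most [A * r ^ s], and 1 makes the sum positive. *)
apply: (@hausdorff_measure_neq0 _ _ D s0 s (B + A + 1) (fun J => P (n J)) w K) => //.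
- by rewrite ltr_wpDl// addr_ge0.
- move=> r r0.
  have [r_ge|r_lt] := leP (rho 0%N) r.
    exists 0%N => J y _; apply: (@le_trans _ _ 1).
      rewrite -(w_sum J) [leLHS]big_mkcond; apply: ler_sum => q _; by case: ifP.
    apply: (@le_trans _ _ (A * r `^ s)).
      rewrite /A mulrC ler_pdivlMr ?powR_gt0// mul1r -rho0.
      by apply: ge0_ler_powR; rewrite ?nnegrE// ltW.
    by rewrite ler_wpM2r ?powR_ge0//; lra.
  have : exists j, rho j <= r.
    have rho_le j : rho j <= rho 0%N / 2 ^+ j.
      elim: j => [|j ih]; first by rewrite expr0 divr1.
      apply: le_trans (rhoS j) _; rewrite exprS invfM mulrCA.
      by have := rho_gt0 j; lra.
    have [k hk] : exists k : nat, rho 0%N / r < k%:R.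
      by exists (Num.truncn (rho 0%N / r)).+1; exact: truncnS_gt.
    exists k; apply: le_trans (rho_le k) _; rewrite ler_pdivrMr ?exprn_gt0//.
    rewrite mulrC -ler_pdivrMr//; apply: le_trans (ltW hk) _.
    by rewrite -natrX ler_nat ltnW// ltn_expl.
  (* The least level with [rho j.+1 <= r] places [r] between two consecutive radii. Later levels
     move mass by less than [rho j.+1 <= r], whence the radius [2 * r] in [refines]. *)
  move=> ex; case: (ex_minnP ex) => -[|j] jr jmin; first by move: r_lt; rewrite ltNge jr.
  have jr' : r < rho j by rewrite ltNge; apply/negP => /jmin; rewrite ltnn.
  exists j.+1 => J y jJ; apply: le_trans (flow j.+1 J y r jJ) _.
  have [_ _ _ _ hb] := fR j.
  apply: (@le_trans _ _ (B * r `^ s)); last by rewrite ler_wpM2r ?powR_ge0//; lra.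
  apply: le_trans (hb y r jr jr').
  rewrite big_mkcond [leRHS]big_mkcond; apply: ler_sum => q _.
  have := rho_gt0 J; case: ifPn => h3 h4; last by case: ifPn => // _; exact: (w_ge0 j.+1).
  by rewrite ifT//; apply: lt_le_trans h3 _; lra.
- move=> j; rewrite /K; elim: (P (n j)) => [|a l ih].
    rewrite (_ : mkset _ = set0); first exact: compact0.
    by apply/seteqP; split => // x [q []].
  have [wa|wa] := boolP (0 < w j a).
    rewrite (_ : mkset _ = ecball a (rho j) `|`
       [set x | exists q, [/\ q \in l, 0 < w j q & ecball q (rho j) x]]).
      by apply: compactU => //; exact: ecball_compact.
    apply/seteqP; split => x /=.
      by move=> [q []]; rewrite inE => /orP[/eqP ->|ql] wq qx; [left|right; exists q].
    case=> [ax|[q [ql wq qx]]]; first by exists a; rewrite mem_head.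
    by exists q; rewrite inE ql orbT.
  rewrite (_ : mkset _ = [set x | exists q, [/\ q \in l, 0 < w j q & ecball q (rho j) x]])//.
  apply/seteqP; split => x /= [q []].
    by rewrite inE => /orP[/eqP ->|ql] wq qx; [rewrite wq in wa|exists q].
  by move=> ql wq qx; exists q; rewrite inE ql orbT.
- move=> j J p jJ pP wp; have [q [qP wq pq]] := trace j J p jJ pP wp.
  exists q; split => //; rewrite /ecball/=; apply: le_trans pq _.
  by rewrite gerBl ltW.
- move=> x xK; apply: DP => M; have [q [qP _ xq]] := xK M I.
  by exists (n M), q.
Qed.

End LimsupBalls.

(** * Differentiable maps with conformal derivative *)

Section ConformalMaps.
Context {R : realType} {d : nat}.
Implicit Types (f g : 'rV[R]_d -> 'rV[R]_d) (x y z u v p : 'rV[R]_d).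

(** The first-order expansion along a line, without division so that [t = 0] is allowed; the factor
    [d + 1] in the tolerance absorbs the passage from the sup norm to the Euclidean norm. *)
Lemma diff_quotient f p v (e : R) : differentiable f p -> 0 < e ->
  exists2 del, 0 < del & forall t, `|t| < del ->
    enorm (f (t *: v + p) - f p - t *: 'd f p v) <= e * `|t|.
Proof.
move=> df e0; have := diff_derivable (v := v) df.
rewrite /derivable => /cvg_ex[l hl].
have ll : l = 'd f p v by rewrite -deriveE// /derive; apply/esym/cvg_lim.
have e1 : 0 < e / (d%:R + 1) by rewrite divr_gt0// ltr_wpDl.
move: hl => /cvgrPdist_lt/(_ _ e1)[del /= del0 hdel].
exists del => // t td.
have [->|t0] := eqVneq t 0.
  by rewrite !scale0r add0r !subrr enorm0 normr0 mulr0.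
have := hdel t; rewrite /= sub0r normrN => /(_ td t0) h.
have -> : f (t *: v + p) - f p - t *: 'd f p v =
   (- t) *: (l - t^-1 *: (f (t *: v + p) - f p)).
  by rewrite scalerBr ll !scaleNr opprK scalerA mulfV// scale1r addrC.
rewrite enormZ normrN mulrC ler_wpM2r// (le_trans (enorm_le_normr _))//.
rewrite (@le_trans _ _ (d%:R * (e / (d%:R + 1))))//; first by rewrite ler_wpM2l// ltW.
rewrite mulrA ler_pdivrMr ?ltr_wpDl// mulrC ler_wpM2l ?(ltW e0)//.
by rewrite lerDl.
Qed.


Lemma is_derive_dotv f p u v (c : R) : differentiable f (c *: v + p) ->
  is_derive c 1 (fun t => dotv u (f (t *: v + p))) (dotv u ('d f (c *: v + p) v)).
Proof.
move=> df; set l := dotv u _.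
have cv : (fun k => k^-1 *: (((fun t => dotv u (f (t *: v + p))) \o shift c) (k *: 1)
    - dotv u (f (c *: v + p)))) @ 0^' --> l.
  apply/cvgrPdist_le => e e0.
  have u0 : 0 < enorm u + 1 by rewrite ltr_wpDl ?enorm_ge0.
  have [del del0 hdel] := diff_quotient v df (divr_gt0 e0 u0).
  exists del => // k; rewrite /= sub0r normrN => kdel k0.
  set p' := c *: v + p in df l hdel *.
  have -> : (k *: 1 + c) *: v + p = k *: v + p'.
    by rewrite /p' addrA -scalerDl; congr (_ *: _ + _); rewrite [_ *: _]mulr1.
  have -> : l - k^-1 *: (dotv u (f (k *: v + p')) - dotv u (f p')) =
     - k^-1 * dotv u (f (k *: v + p') - f p' - k *: 'd f p' v).
    rewrite !dotvDr !dotvNr dotvZr -/l [_ *: (_ - _)]mulrDr.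
    by field.
  rewrite normrM normrN normfV ler_pdivrMl ?normr_gt0//.
  have abs_dotv (a b : 'rV[R]_d) : `|dotv a b| <= enorm a * enorm b.
    rewrite ler_norml cauchy_schwarz andbT lerNl -dotvNr.
    by rewrite -(enormN b) cauchy_schwarz.
  apply: le_trans (abs_dotv _ _) _.
  apply: le_trans (ler_wpM2l (enorm_ge0 u) (hdel k kdel)) _.
  rewrite mulrA mulrC ler_wpM2l// mulrCA ger_pMr// ler_pdivrMr// mul1r lerDl//.
by constructor; [apply/cvg_ex; exists l|exact/cvg_lim].
Qed.

(** The scalar mean value theorem for [t |-> dotv u (f (t *: v + x))] with [u = f y - f x] expresses
    [enorm u ^+ 2] as the product of [u] with a derivative of [f] along [v]; Cauchy-Schwarz then
    cancels one factor [enorm u]. *)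
Lemma mean_value f x y (M : R) :
  (forall t, 0 <= t <= 1 -> differentiable f (t *: (y - x) + x) /\
     forall w, enorm ('d f (t *: (y - x) + x) w) <= M * enorm w) ->
  enorm (f y - f x) <= M * enorm (y - x).
Proof.
move=> hf; set u := f y - f x; set v := y - x in hf *.
pose g t := dotv u (f (t *: v + x)).
pose dg t := dotv u ('d f (t *: v + x) v).
have [||c c01] := @MVT_segment R g dg 0 1 ler01.
- move=> t; rewrite in_itv/= => /andP[t0 t1]; apply: is_derive_dotv.
  by have [] := hf t; rewrite ?ltW.
- apply: derivable_within_continuous => t; rewrite in_itv/= => /hf[df _].
  by have [] := is_derive_dotv u df.
rewrite /g scale1r scale0r add0r subrK subr0 mulr1.
have -> : dotv u (f y) - dotv u (f x) = enorm u ^+ 2.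
  by rewrite sqr_enorm {4}/u dotvDr dotvNr.
move=> h; have [->|u0] := eqVneq u 0.
  have [_ /(_ v)] := hf 0 (ltac:(by rewrite lexx ler01)).
  by rewrite enorm0; apply: le_trans; exact: enorm_ge0.
rewrite -(ler_pM2l (x := enorm u)) ?enorm_gt0// -expr2 h.
apply: le_trans (cauchy_schwarz _ _) _; rewrite ler_wpM2l ?enorm_ge0//.
by move: c01; rewrite in_itv/= => /hf[].
Qed.

(** A similarity is injective, hence onto in finite dimension. *)
Lemma similarity_surj (c : R) (L : {linear 'rV[R]_d -> 'rV[R]_d}) w :
  similarity c L -> exists v, L v = w.
Proof.
move=> [c0 Lc]; have free : row_free (lin1_mx L).
  apply: inj_row_free => v; rewrite mul_rV_lin1 => Lv.
  apply/eqP; rewrite -enorm_eq0.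
  have /eqP := Lc v; rewrite Lv enorm0 eq_sym mulf_eq0 (gt_eqF c0)/= => /eqP ->.
  by rewrite eqxx.
exists (w *m invmx (lin1_mx L)).
by rewrite -mul_rV_lin1 mulmxKV// -row_free_unit.
Qed.

(* Minimizing [enorm (f y - z) + m' * enorm (y - x)], with [m'] slightly below
   [m], replaces the inverse function theorem, which would need [f] to be C^1. *)
Lemma conformal_covering f x (eps m : R) : 0 < eps -> 0 < m ->
  (forall y, eball x eps y -> differentiable f y /\
     exists2 c, m <= c & similarity c ('d f y)) ->
  eball (f x) (m * eps) `<=` f @` eball x eps.
Proof.
move=> eps0 m0 hf z; rewrite /eball/= => zfx.
set D := enorm (z - f x) in zfx; have D0 : 0 <= D by exact: enorm_ge0.
(* [e'] and then [m'] are chosen so that [m' * e'] exceeds [D], the value of [G] at [x]: a minimizer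
   over the closed ball of radius [e'] then stays off the boundary sphere. *)
have [e' [De' e'eps]] : exists e', D / m < e' /\ e' < eps.
  exists ((D / m + eps) / 2); have : D / m < eps by rewrite ltr_pdivrMr// mulrC.
  by lra.
have e'0 : 0 < e' by apply: le_lt_trans De'; rewrite divr_ge0// ltW.
have [m' [Dm' m'm]] : exists m', D / e' < m' /\ m' < m.
  exists ((D / e' + m) / 2).
  have : D / e' < m by rewrite ltr_pdivrMr// mulrC -ltr_pdivrMr.
  by lra.
have m'0 : 0 <= m' by apply: ltW; apply: le_lt_trans Dm'; rewrite divr_ge0// ltW.
pose G y := enorm (f y - z) + m' * enorm (y - x).
have sub y : ecball x e' y -> eball x eps y by move=> /le_lt_trans; apply.
have [||y ye' ymin] := @EVT_min_rV R d G (ecball x e') _ (ecball_compact (x:=x) (r:=e')).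
- by exists x; rewrite /ecball/= subrr enorm0 ltW.
- apply: continuous_in_subspaceT => y; rewrite inE => /sub /hf[df _].
  apply: (@continuousD _ _ _ (fun y => enorm (f y - z)) (fun y => m' * enorm (y - x))).
    apply: (@continuous_comp _ _ _ f (fun y => enorm (y - z))).
      exact: differentiable_continuous.
    exact: enormB_continuous.
  apply: (@continuousM _ _ (fun=> m') (fun y => enorm (y - x))); first exact: cst_continuous.
  exact: enormB_continuous.
have Gy : G y <= D.
  have := ymin x; rewrite {2}/G subrr enorm0 mulr0 addr0 enormB; apply.
  by rewrite inE /ecball/= subrr enorm0 ltW.
have ylt : enorm (y - x) < e'.
  rewrite ltNge; apply/negP => h; move: Gy; apply/negP; rewrite -ltNge /G.
  rewrite ltr_wpDl ?enorm_ge0//; apply: lt_le_trans (ler_wpM2l m'0 h).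
  by rewrite -ltr_pdivrMr.
have ysub : eball x eps y by apply: lt_trans ylt _.
exists y => //; apply: contrapT => fyz.
have [dfy [c mc simc]] := hf y ysub.
pose w := z - f y.
have w0 : 0 < enorm w by rewrite enorm_gt0 subr_eq0; apply/eqP => /esym.
(* Moving from [y] along [v], the first term of [G] drops at rate [enorm w] up to a small error, and
   the second grows at rate at most [m' * enorm v < enorm w]. So [y] would not be a minimizer. *)
have [v vw] := similarity_surj w simc.
have vle : m * enorm v <= enorm w.
  by have [_ /(_ v)] := simc; rewrite vw => ->; rewrite ler_wpM2r ?enorm_ge0.
have v0 : 0 < enorm v.
  have [c0 /(_ v)] := simc; rewrite vw => wv.
  by move: w0; rewrite wv pmulr_rgt0.
have gap : 0 < (enorm w - m' * enorm v) / 2.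
  by rewrite divr_gt0// subr_gt0; apply: lt_le_trans vle; rewrite ltr_pM2r.
have [del del0 hdel] := diff_quotient v dfy gap.
pose t := Num.min (Num.min 1 (del / 2)) ((e' - enorm (y - x)) / enorm v).
have t0 : 0 < t by rewrite !lt_min ltr01 !divr_gt0 ?subr_gt0.
have t1 : t <= 1 by rewrite !ge_min lexx.
have tdel : t < del.
  by rewrite (@le_lt_trans _ _ (del / 2))// ?ge_min ?lexx ?orbT//; lra.
have tv : t * enorm v <= e' - enorm (y - x).
  by rewrite -ler_pdivlMr// ge_min lexx orbT.
have ty : enorm (t *: v + y - x) <= enorm (y - x) + t * enorm v.
  rewrite -addrA addrC (le_trans (enormD _ _))// lerD2l enormZ ger0_norm//.
  exact: ltW.
have : G y <= G (t *: v + y).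
  by apply: ymin; rewrite inE /ecball/= (le_trans ty)//; lra.
have := hdel t; rewrite ger0_norm ?(ltW t0)// => /(_ tdel) hq.
have ft : enorm (f (t *: v + y) - z) <=
   (1 - t) * enorm w + (enorm w - m' * enorm v) / 2 * t.
  have -> : f (t *: v + y) - z = - ((1 - t) *: w) + (f (t *: v + y) - f y - t *: 'd f y v).
    by rewrite vw /w; apply/rowP => i; rewrite !mxE; ring.
  rewrite (le_trans (enormD _ _))// lerD// enormN enormZ ger0_norm// subr_ge0//.
rewrite /G -/w (enormB (f y)) -/w => hG.
have := ler_wpM2l m'0 ty; rewrite mulrDr => h2.
have : 0 < t * (enorm w - m' * enorm v) by rewrite mulr_gt0//; lra.
by lra.
Qed.

(** Compare the Lipschitz bound with the first-order expansion in a single direction; [0 < d]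
    supplies a nonzero vector. *)
Lemma lipschitz_factor f x (V : set 'rV[R]_d) (k c : R) : open V -> V x -> (0 < d)%N ->
  differentiable f x -> similarity c ('d f x) ->
  (forall y z, V y -> V z -> enorm (f y - f z) <= k * enorm (y - z)) -> c <= k.
Proof.
move=> oV Vx d0 df [c0 simc] lip.
pose v : 'rV[R]_d := \row_i 1.
have v0 : 0 < enorm v.
  rewrite enorm_gt0; apply/eqP => /rowP/(_ (Ordinal d0)).
  by rewrite !mxE => /eqP; rewrite oner_eq0.
rewrite -(ler_pM2r v0) -simc; apply/ler_addgt0Pr => e e0.
have [del del0 hdel] := diff_quotient v df e0.
have [r r0 rV] : exists2 r, 0 < r & eball x r `<=` V.
  by apply: open_eballP; move: oV; rewrite openE => /(_ x Vx).
pose t := Num.min (del / 2) (r / enorm v / 2).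
have t0 : 0 < t by rewrite lt_min !divr_gt0.
have tdel : t < del.
  by rewrite (@le_lt_trans _ _ (del / 2))// ?ge_min ?lexx ?orbT//; lra.
have tr : t * enorm v < r.
  rewrite -ltr_pdivlMr// (@le_lt_trans _ _ (r / enorm v / 2))// ?ge_min ?lexx ?orbT//.
  by have : 0 < r / enorm v by [rewrite divr_gt0]; lra.
have := hdel t; rewrite ger0_norm ?(ltW t0)// => /(_ tdel) hq.
have Vt : V (t *: v + x).
  by apply: rV; rewrite /eball/= addrK enormZ ger0_norm ?(ltW t0).
have := lip _ _ Vt Vx; rewrite addrK enormZ ger0_norm ?(ltW t0)// => h.
rewrite -(ler_pM2l t0) -[t in leLHS](ger0_norm (ltW t0)) -enormZ.
have := enorm_triangle (f (t *: v + x) - f x) (t *: 'd f x v) 0.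
by rewrite !subr0 (enormB (t *: _)); lra.
Qed.

Lemma similarity_unique (c c' : R) (L : 'rV[R]_d -> 'rV[R]_d) : (0 < d)%N ->
  similarity c L -> similarity c' L -> c = c'.
Proof.
move=> d0 [_ h] [_ h']; pose v : 'rV[R]_d := \row_i 1.
have v0 : enorm v != 0.
  rewrite enorm_eq0; apply/eqP => /rowP/(_ (Ordinal d0)).
  by rewrite !mxE => /eqP; rewrite oner_eq0.
by apply: (mulIf v0); rewrite -h -h'.
Qed.

Lemma conformal_factorE f x (c : R) : (0 < d)%N -> similarity c ('d f x) ->
  conformal_factor f x = c.
Proof.
move=> d0 sc; have h : similarity (conformal_factor f x) ('d f x).
  by rewrite /conformal_factor; apply: (@xgetPex _ 0 [set c | similarity c ('d f x)]); exists c.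
exact: similarity_unique h sc.
Qed.

Lemma similarity_comp f g x (c c' : R) :
  differentiable f x -> differentiable g (f x) ->
  similarity c ('d f x) -> similarity c' ('d g (f x)) ->
  similarity (c' * c) ('d (g \o f) x).
Proof.
move=> df dg [c0 sc] [c0' sc']; split; first exact: mulr_gt0.
have E := diff_comp df dg.
move=> v; have Ev : 'd (g \o f) x v = 'd g (f x) ('d f x v) := congr1 (fun k => k v) E.
rewrite Ev; apply: etrans (sc' _) _.
by rewrite -mulrA; congr (_ * _); exact: sc.
Qed.

Lemma differentiable_id x : differentiable (@id 'rV[R]_d) x.
Proof. exact: ex_diff. Qed.

Lemma similarity_id x : similarity 1 ('d (@id 'rV[R]_d) x).
Proof. by split => // v; rewrite diff_val mul1r. Qed.

End ConformalMaps.

(** * Words and cylinders *)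

Section Words.
Context {T : choiceType}.
Implicit Types (I : nat -> set T) (u w : seq T).

Lemma admissible_cat I m u w :
  admissible I m (u ++ w) <-> admissible I m u /\ admissible I (m + size u) w.
Proof.
elim: u m => [|a u ih] m /=; first by rewrite addn0; tauto.
by rewrite ih addSnnS; tauto.
Qed.

Lemma words_exist I m n : (forall k, (m <= k)%N -> I k !=set0) -> words I m n !=set0.
Proof.
elim: n m => [|n ih] m I0; first by exists [::].
have [a Ia] := I0 m (leqnn m).
have [|w [sw aw]] := ih m.+1; first by move=> k mk; apply: I0; exact: ltnW.
by exists (a :: w); split => //=; rewrite sw.
Qed.

Lemma words_finite I m n : (forall k, (m <= k)%N -> finite_set (I k)) ->
  finite_set (words I m n).
Proof.
elim: n m => [|n ih] m fI.
  by apply: (@sub_finite_set _ _ [set [::]]) => // w [/size0nil ->].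
apply: (@sub_finite_set _ _ ((fun aw => aw.1 :: aw.2) @` (I m `*` words I m.+1 n))).
  by move=> [|a w] [//= [sw] [Ia aw]]; exists (a, w).
apply: finite_image; apply: finite_setX; first exact: fI.
by apply: ih => k mk; apply: fI; exact: ltnW.
Qed.

Lemma admissible_mkseq I m (z : nat -> T) k : infwords I m z -> admissible I m (mkseq z k).
Proof.
elim: k => [//|k ih] zI; rewrite /mkseq -addn1 iotaD map_cat.
apply/admissible_cat; split; first exact: ih.
by rewrite size_map size_iota add0n /=; split => //; exact: zI.
Qed.

Lemma word_cat_infwords I n w z : words I 1 n w -> infwords I n.+1 z ->
  infwords I 1 (word_cat w z).
Proof.
move=> [<- {n}]; suff: forall m, admissible I m w -> infwords I (m + size w) z ->
  infwords I m (word_cat w z) by apply.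
elim: w => [|a w ih] m /=.
  by move=> _ zI k; rewrite /word_cat nth_nil /= subn0 -(addn0 m); exact: zI.
move=> [Ia aw] zI [|k]; first by rewrite addn0.
by rewrite addnS -addSn; apply: ih aw _ k; rewrite addSnnS.
Qed.

Lemma iter_wshift (z : nat -> T) k i : iter k wshift z i = z (k + i)%N.
Proof. by elim: k i => [//|k ih] i /=; rewrite /wshift ih addnS. Qed.

Lemma infwords_shift I m k (z : nat -> T) : infwords I m z -> infwords I (m + k) (iter k wshift z).
Proof. by move=> zI i; rewrite iter_wshift -addnA; exact: zI. Qed.

End Words.

(** * Derivatives of compositions along words *)

Section ConformalIFS.
Context {R : realType} {d : nat} {T : choiceType}.
Variables (X V : set 'rV[R]_d) (I : nat -> set T) (phi : nat -> T -> 'rV[R]_d -> 'rV[R]_d).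
Hypothesis d_gt0 : (0 < d)%N.
Hypothesis hifs : conformal_ifs X V I phi.
Implicit Types (u w : seq T) (x y : 'rV[R]_d).

Lemma word_map_cat m u w :
  word_map phi m (u ++ w) = word_map phi m u \o word_map phi (m + size u) w.
Proof.
elim: u m => [|a u ih] m /=; first by rewrite addn0.
by rewrite ih addSnnS.
Qed.

Let XV : X `<=` V. Proof. by have [_ []] := hifs. Qed.
Let oV : open V. Proof. by have [_ []] := hifs. Qed.
Let Xc : compact X. Proof. by have [[]] := hifs. Qed.
Let I0 k : (0 < k)%N -> I k !=set0.
Proof. by have [_ _ h _] := hifs => /h[]. Qed.
Let phiP n j : (0 < n)%N -> I n j -> conformal_contraction V (phi n j) /\ phi n j @` X `<=` X.
Proof. by have [_ _ _ h] := hifs; exact: h. Qed.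

Lemma word_map_V m w x : (0 < m)%N -> admissible I m w -> V x -> V (word_map phi m w x).
Proof.
elim: w m => [//|a w ih] m m0 [Ia aw] Vx /=.
have [[h _ _] _] := phiP m0 Ia; apply: h; exact: ih.
Qed.

Lemma word_map_X m w x : (0 < m)%N -> admissible I m w -> X x -> X (word_map phi m w x).
Proof.
elim: w m => [//|a w ih] m m0 [Ia aw] Xx /=.
have [_ h] := phiP m0 Ia; apply: h; exists (word_map phi m.+1 w x) => //; exact: ih.
Qed.

Lemma letter_factor n j x : (0 < n)%N -> I n j -> V x ->
  [/\ differentiable (phi n j) x,
      similarity (conformal_factor (phi n j) x) ('d (phi n j) x) &
      conformal_factor (phi n j) x <= 1].
Proof.
move=> n0 Ij Vx; have [[_ h [s [s1 hs]]] _] := phiP n0 Ij.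
have [df [c sc]] := h x Vx; split => //; rewrite (conformal_factorE d_gt0 sc)//.
by apply: le_trans (ltW s1); exact: (lipschitz_factor oV Vx d_gt0 df sc hs).
Qed.

Lemma word_factor m w x : (0 < m)%N -> admissible I m w -> V x ->
  differentiable (word_map phi m w) x /\
  similarity (conformal_factor (word_map phi m w) x) ('d (word_map phi m w) x).
Proof.
elim: w m => [|a w ih] m m0 aw Vx.
  split; first exact: differentiable_id.
  by rewrite (conformal_factorE d_gt0 (similarity_id x)); exact: similarity_id.
case: aw => Ia aw; have [dw sw] := ih m.+1 isT aw Vx.
have [da sa _] := letter_factor m0 Ia (word_map_V (isT : (0 < m.+1)%N) aw Vx).
split; first exact: (differentiable_comp dw da).
have sc := similarity_comp dw da sw sa.
by rewrite (conformal_factorE d_gt0 sc).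
Qed.

Lemma word_factor_gt0 m w x : (0 < m)%N -> admissible I m w -> V x ->
  0 < conformal_factor (word_map phi m w) x.
Proof. by move=> m0 aw Vx; have [_ []] := word_factor m0 aw Vx. Qed.

Lemma word_factor_cat m u w x : (0 < m)%N -> admissible I m (u ++ w) -> V x ->
  conformal_factor (word_map phi m (u ++ w)) x =
  conformal_factor (word_map phi m u) (word_map phi (m + size u) w x) *
  conformal_factor (word_map phi (m + size u) w) x.
Proof.
move=> m0 /admissible_cat[au aw] Vx.
have mu0 : (0 < m + size u)%N by rewrite addn_gt0 m0.
have [dw sw] := word_factor mu0 aw Vx.
have [du su] := word_factor m0 au (word_map_V mu0 aw Vx).
have sc := similarity_comp dw du sw su.
by rewrite word_map_cat (conformal_factorE d_gt0 sc).
Qed.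

Lemma word_factor_cons m a w x : (0 < m)%N -> admissible I m (a :: w) -> V x ->
  conformal_factor (word_map phi m (a :: w)) x =
  conformal_factor (phi m a) (word_map phi m.+1 w x) *
  conformal_factor (word_map phi m.+1 w) x.
Proof.
move=> m0 aw Vx; have := @word_factor_cat m [:: a] w x m0 aw Vx.
by rewrite addn1.
Qed.

Lemma word_factor_nil m x : conformal_factor (word_map phi m [::]) x = 1.
Proof. exact: conformal_factorE d_gt0 (similarity_id x). Qed.

Lemma word_factor_le1 m w x : (0 < m)%N -> admissible I m w -> V x ->
  conformal_factor (word_map phi m w) x <= 1.
Proof.
elim: w m => [|a w ih] m m0 aw Vx; first by rewrite word_factor_nil.
rewrite word_factor_cons//; case: aw => Ia aw.
have [_ [a0 _] a1] := letter_factor m0 Ia (word_map_V (isT : (0 < m.+1)%N) aw Vx).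
apply: mulr_ile1; [exact: ltW a0| |exact: a1|exact: ih].
by apply: ltW; exact: word_factor_gt0.
Qed.

Lemma word_map_continuous m w x : (0 < m)%N -> admissible I m w -> V x ->
  {for x, continuous (word_map phi m w)}.
Proof. by move=> m0 aw Vx; apply: differentiable_continuous; have [] := word_factor m0 aw Vx. Qed.

Lemma word_image_compact m w : (0 < m)%N -> admissible I m w ->
  compact (word_map phi m w @` X).
Proof.
move=> m0 aw; apply: continuous_compact => //.
by apply: continuous_in_subspaceT => x; rewrite inE => /XV; exact: word_map_continuous.
Qed.

Lemma segment_in_X x y (t : R) : X x -> X y -> 0 <= t <= 1 -> X (t *: (y - x) + x).
Proof.
move=> Xx Xy t01; have [[_ cX _] _ _ _] := hifs.
case/andP: t01 => t0 t1; have := cX y x (Itv01 t0 t1).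
rewrite !inE => /(_ Xy Xx); congr (X _).
have <- : t *: y + (1 - t) *: x = t *: (y - x) + x; last by [].
by rewrite scalerBl scale1r scalerBr addrA [LHS]addrAC.
Qed.

End ConformalIFS.

(** * Cylinders and coded points *)

Section Cylinders.
Context {R : realType} {d : nat} {T : choiceType}.
Variables (X V : set 'rV[R]_d) (I : nat -> set T) (phi : nat -> T -> 'rV[R]_d -> 'rV[R]_d).
Hypothesis d_gt0 : (0 < d)%N.
Hypothesis hifs : conformal_ifs X V I phi.
Implicit Types (u w : seq T) (x y : 'rV[R]_d).

Let XV : X `<=` V. Proof. by have [_ []] := hifs. Qed.
Let Xc : compact X. Proof. by have [[]] := hifs. Qed.
Let X0 : X !=set0.
Proof. by have [[_ _ [x Xx]] _ _ _] := hifs; exists x; exact: interior_subset. Qed.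
Let I0 k : (0 < k)%N -> I k !=set0.
Proof. by have [_ _ h _] := hifs => /h[]. Qed.

Lemma cylinder_lipschitz m w (M : R) x y : (0 < m)%N -> admissible I m w ->
  (forall z, X z -> conformal_factor (word_map phi m w) z <= M) -> X x -> X y ->
  enorm (word_map phi m w y - word_map phi m w x) <= M * enorm (y - x).
Proof.
move=> m0 aw wM Xx Xy; apply: mean_value => t t01.
have Xt := segment_in_X hifs Xx Xy t01.
have [dw [_ sw]] := word_factor d_gt0 hifs m0 aw (XV Xt).
split=> [//|v]; rewrite (sw v) ler_wpM2r ?enorm_ge0//; exact: wM.
Qed.

(** Nested nonempty compact sets have a common point, so the [xget] in [coding] never falls back on
    its default 0. The case [k = 0] follows from [k = 1]. *)
Lemma coding_mem n (z : nat -> T) k : infwords I n.+1 z ->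
  (word_map phi n.+1 (mkseq z k) @` X) (coding X phi n z).
Proof.
move=> zI; pose K j := word_map phi n.+1 (mkseq z j) @` X.
have KS j : K j.+1 `<=` K j.
  have mkS : mkseq z j.+1 = mkseq z j ++ [:: z j] by rewrite mkseqS cats1.
  rewrite /K mkS word_map_cat => _ [x Xx <-].
  exists (word_map phi (n.+1 + size (mkseq z j)) [:: z j] x) => //.
  apply: (word_map_X hifs) => //.
  by have := admissible_mkseq j.+1 zI; rewrite mkS => /admissible_cat[].
have [p Kp] : \bigcap_j K j !=set0.
  apply: nested_compact => // j.
    by apply: (word_image_compact d_gt0 hifs) => //; exact: admissible_mkseq.
  by have [x Xx] := X0; exists (word_map phi n.+1 (mkseq z j) x); exists x.
have h : (\bigcap_(k in [set k | (0 < k)%N]) (word_map phi n.+1 (mkseq z k) @` X))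
    (coding X phi n z).
  by apply: xgetPex; exists p => j _; exact: Kp.
by case: k => [|k]; [apply: (KS 0%N); exact: h|exact: h].
Qed.

Lemma coding_X n (z : nat -> T) : infwords I n.+1 z -> X (coding X phi n z).
Proof. by move=> /(@coding_mem n z 0)[x Xx <-]. Qed.

(** For [k <= n] the level [k] cylinder is that of a prefix of [w]; for larger [k] it is that of [w]
    continued by letters of [z]. *)
Lemma limit_set_coding n w (z : nat -> T) : words I 1 n w -> infwords I n.+1 z ->
  limit_set X I phi (word_map phi 1 w (coding X phi n z)).
Proof.
move=> [sw aw] zI k k0; have [kn|nk] := leqP k n.
  exists (take k w).
    split; first by rewrite size_takel// sw.
    by move: aw; rewrite -{1}(cat_take_drop k w) => /admissible_cat[].
  move: aw; rewrite -{1}(cat_take_drop k w) => /admissible_cat[_ aw].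
  rewrite -{2}(cat_take_drop k w) word_map_cat.
  exists (word_map phi (1 + size (take k w)) (drop k w) (coding X phi n z)) => //.
  by apply: (word_map_X hifs) => //; exact: coding_X.
have [x Xx xE] := coding_mem (k - n) zI.
exists (w ++ mkseq z (k - n)).
  split; first by rewrite size_cat sw size_mkseq subnKC// ltnW.
  by apply/admissible_cat; split => //; rewrite sw add1n; exact: admissible_mkseq.
by exists x => //; rewrite word_map_cat sw add1n /= xE.
Qed.

(** * Inner balls and separation of cylinders *)

Section Separation.
Hypothesis hinj : forall n j, (0 < n)%N -> I n j -> set_inj V (phi n j).
Hypothesis osc : forall n i j, (0 < n)%N -> I n i -> I n j -> i <> j ->
  (phi n i @` X°) `&` (phi n j @` X°) = set0.
Variable K : R.
Hypothesis K1 : 1 <= K.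
Hypothesis distortion : forall n w x y, (0 < n)%N -> words I 1 n w -> X x -> X y ->
  conformal_factor (word_map phi 1 w) x <= K * conformal_factor (word_map phi 1 w) y.

(* Prefix [w] by a word of length [m - 1], so that bounded distortion applies. *)
Lemma word_factor_lower m w : (0 < m)%N -> admissible I m w ->
  exists2 c, 0 < c & forall x, X x -> c <= conformal_factor (word_map phi m w) x.
Proof.
case: m => // m _ aw; have [x0 Xx0] := X0.
have [u [su au]] : words I 1 m !=set0 by apply: words_exist => k; exact: I0.
have auw : admissible I 1 (u ++ w) by apply/admissible_cat; rewrite su.
have [/eqP|n0] := posnP (size (u ++ w)).
  rewrite size_cat addn_eq0 => /andP[_ /nilP ->].
  by exists 1 => // x _; rewrite word_factor_nil.
have K0 : 0 < K by exact: lt_le_trans K1.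
exists (conformal_factor (word_map phi 1 (u ++ w)) x0 / K).
  by rewrite divr_gt0//; apply: (word_factor_gt0 d_gt0 hifs _ auw) => //; exact: XV.
move=> x Xx; rewrite ler_pdivrMr// mulrC.
apply: le_trans (distortion n0 (conj erefl auw) Xx0 Xx) _.
(* By the chain rule, the factor of [u ++ w] is at most that of [w], since the prefix contributes at
   most 1. *)
rewrite (ler_pM2l K0) (word_factor_cat d_gt0 hifs (isT : (0 < 1)%N) auw (XV Xx)) su add1n.
apply: ler_piMl; first by apply: ltW; apply: (word_factor_gt0 d_gt0 hifs) => //; exact: XV.
apply: (word_factor_le1 d_gt0 hifs) => //.
by apply: XV; apply: (word_map_X hifs).
Qed.

Lemma cylinder_ball m w x (eps k : R) : (0 < m)%N -> admissible I m w ->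
  0 < eps -> 0 < k -> eball x eps `<=` X ->
  (forall y, X y -> k <= conformal_factor (word_map phi m w) y) ->
  eball (word_map phi m w x) (k * eps) `<=` word_map phi m w @` eball x eps.
Proof.
move=> m0 aw eps0 k0 eX hk; apply: conformal_covering => // y /eX Xy.
have [dy sy] := word_factor d_gt0 hifs m0 aw (XV Xy).
by split => //; exists (conformal_factor (word_map phi m w) y) => //; exact: hk.
Qed.

Lemma eball_interior x (eps : R) : eball x eps `<=` X -> eball x eps `<=` X°.
Proof. by move=> eX; rewrite -open_subsetE//; exact: eball_open. Qed.

(** The image of a ball in [X] around [x] contains a ball around the image point. This allows the
    open set condition to be used after further letters have been applied. *)
Lemma word_map_interior m w x : (0 < m)%N -> admissible I m w -> X° x ->
  X° (word_map phi m w x).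
Proof.
move=> m0 aw /open_eballP[r r0 rX].
have [c c0 hc] := word_factor_lower m0 aw.
rewrite /interior; apply: (@filterS _ (nbhs (word_map phi m w x)) _
  (eball (word_map phi m w x) (c * r))); last first.
  by apply: nbhs_eball; rewrite mulr_gt0.
move=> y /(cylinder_ball m0 aw r0 c0 rX hc)[z /rX Xz <-].
exact: (word_map_X hifs).
Qed.

(** Different first letters contradict the open set condition, because the remaining words keep
    interior points interior; equal first letters are cancelled by injectivity. *)
Lemma word_map_separated m w w' x y : (0 < m)%N -> admissible I m w -> admissible I m w' ->
  size w = size w' -> X° x -> X° y ->
  word_map phi m w x = word_map phi m w' y -> w = w'.
Proof.
elim: w m w' => [|a w ih] m [|b w']//= m0 [Ia aw] [Ib bw] [sw] Xx Xy e.
have Xwx := word_map_interior (isT : (0 < m.+1)%N) aw Xx.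
have Xwy := word_map_interior (isT : (0 < m.+1)%N) bw Xy.
have [ab|ab] := pselect (a = b); last first.
  exfalso; have : (phi m a @` X° `&` phi m b @` X°) (phi m a (word_map phi m.+1 w x)).
    by split; [exists (word_map phi m.+1 w x)|exists (word_map phi m.+1 w' y)].
  by rewrite osc.
rewrite -ab in e *; congr cons; apply: (ih m.+1) => //.
by apply: (hinj m0 Ia) => //; rewrite inE; apply: XV; exact: interior_subset.
Qed.

End Separation.
End Cylinders.

(** * Counting points in the support of an Ahlfors regular measure *)

Section AhlforsCounting.
Context {R : realType} {d : nat}.
Variables (mu : {measure set (@borelRd R d) -> \bar R}) (h C : R).
Hypothesis C1 : 1 <= C.
Hypothesis muP : forall x, msupport mu x -> forall r : R, 0 < r -> r <= 1 ->
  ((C^-1 * r `^ h)%:E <= mu (eball x r))%E /\ (mu (eball x r) <= (C * r `^ h)%:E)%E.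
Implicit Types (A B K : set (@borelRd R d)) (l : seq 'rV[R]_d).

Let C0 : 0 < C. Proof. exact: lt_le_trans C1. Qed.

Lemma borelRd_open A : open (A : set 'rV[R]_d) -> measurable A.
Proof. exact: sub_sigma_algebra. Qed.

Lemma borelRd_closed A : closed (A : set 'rV[R]_d) -> measurable A.
Proof.
by move=> cA; rewrite -(setCK A); apply: measurableC; apply: borelRd_open; exact: closed_openC.
Qed.

Lemma borelRd_compact A : compact (A : set 'rV[R]_d) -> measurable A.
Proof.
move=> cA; apply: borelRd_closed.
by apply: (@compact_closed 'rV[R]_d) => //; exact: norm_hausdorff.
Qed.

Let eball_meas x (r : R) : measurable (eball x r : set (@borelRd R d)).
Proof. by apply: borelRd_open; exact: eball_open. Qed.

Lemma measure_bigsetU_le (J : Type) (s : seq J) (F : J -> set (@borelRd R d)) :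
  (forall i, measurable (F i)) ->
  (mu (\big[setU/set0]_(i <- s) F i) <= \sum_(i <- s) mu (F i))%E.
Proof.
move=> mF; elim: s => [|i s ih]; first by rewrite !big_nil measure0.
rewrite !big_cons; apply: (@le_trans _ _ (mu (F i) + mu (\big[setU/set0]_(i <- s) F i))%E).
  by apply: measureU2 => //; exact: bigsetU_measurable.
by rewrite leeD2l.
Qed.

(** Peel off one ball at a time: the others lie in [A] minus that ball. *)
Lemma measure_disjoint_eballs l (r : R) A : uniq l -> measurable A ->
  (forall p q, p \in l -> q \in l -> p <> q -> eball p r `&` eball q r = set0) ->
  (forall p, p \in l -> eball p r `<=` A) ->
  (\sum_(p <- l) mu (eball p r) <= mu A)%E.
Proof.
elim: l A => [|a l ih] A; first by rewrite big_nil.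
move=> /= /andP[al ul] mA dis sub; rewrite big_cons.
rewrite (measureDI mu mA (eball_meas a r)) addeC.
rewrite (_ : A `&` eball a r = eball a r); last first.
  by apply/setIidPr; apply: sub; rewrite mem_head.
rewrite leeD2r//; apply: ih => //.
- exact: measurableD.
- by move=> p q pl ql; apply: dis; rewrite inE ?pl ?ql orbT.
- move=> p pl z pz; split; first by apply: (sub p) pz; rewrite inE pl orbT.
  move=> az; have : (eball p r `&` eball a r) z by [].
  rewrite dis ?mem_head// ?inE ?pl ?orbT// => pa.
  by move: al; rewrite -pa pl.
Qed.

(** Each point off the support has a null open neighbourhood, and finitely many of these cover
    [K]. *)
Lemma compact_null K : compact (K : set 'rV[R]_d) ->
  (forall x, K x -> ~ msupport mu x) -> mu K = 0%E.
Proof.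
move=> cK Kmu.
have /choice[U UP] : forall x, exists U : set 'rV[R]_d,
    open U /\ (K x -> U x /\ mu (U : set (@borelRd R d)) = 0%E).
  move=> x; have [Kx|] := pselect (K x); last by move=> nK; exists set0; split => //; exact: open0.
  apply: contrapT => no; apply: (Kmu x Kx) => U oU Ux.
  rewrite lt0e measure_ge0 andbT; apply/eqP => mU; apply: no.
  by exists U; split.
have := cK; rewrite compact_cover => /(_ _ K U)[|x Kx|D' D'K KD'].
- by move=> x _; have [] := UP x.
- by exists x => //; have [_ /(_ Kx)[]] := UP x.
pose F x : set (@borelRd R d) := if x \in D' then U x else set0.
have mF x : measurable (F x).
  rewrite /F; case: ifP => // _; apply: borelRd_open; by have [] := UP x.
have KF : K `<=` \big[setU/set0]_(x <- finmap.enum_fset D') F x.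
  move=> z /KD'[x /= xD' Uz]; rewrite -bigcup_seq; exists x => //.
  by rewrite /F; rewrite xD'.
apply/eqP; rewrite eq_le measure_ge0 andbT.
apply: (@le_trans _ _ (mu (\big[setU/set0]_(x <- finmap.enum_fset D') F x))).
  apply: le_measure => //; rewrite inE; last exact: bigsetU_measurable.
  exact: borelRd_compact.
apply: le_trans (measure_bigsetU_le _ mF) _.
rewrite big_seq big1// => x xD'; rewrite /F xD'.
have xK : K x by have := D'K x xD'; rewrite inE.
by have [_ /(_ xK)[]] := UP x.
Qed.

(** Volume comparison: the disjoint balls of radius [r0] lie in the ball of radius [3 * r] about one
    of the counted points [p0]. The point [p0] replaces [y], which may lie off the support;
    [r <= 3^-1] keeps the radius at most 1. *)
Lemma ahlfors_count_le l (y : 'rV[R]_d) (r0 r : R) : uniq l ->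
  (forall p, p \in l -> msupport mu p) -> 0 < r0 -> r0 <= r -> r <= 3^-1 ->
  (forall p q, p \in l -> q \in l -> p <> q -> eball p r0 `&` eball q r0 = set0) ->
  (count (fun p => enorm (p - y) < r) l)%:R <= C ^+ 2 * (3 * r / r0) `^ h.
Proof.
move=> ul lmu r00 r0r r3 dis.
have r_gt0 : 0 < r by exact: lt_le_trans r0r.
rewrite -size_filter; set l' := [seq p <- l | _].
have l'P p : p \in l' -> p \in l /\ enorm (p - y) < r.
  by rewrite mem_filter => /andP[].
have [->|[p0 p0l']] : l' = [::] \/ exists p0, p0 \in l'.
  by case: l' {l'P} => [|p0 s]; [left|right; exists p0; rewrite mem_head].
  by rewrite mulr_ge0 ?exprn_ge0 ?powR_ge0// ltW.
have [p0l p0y] := l'P _ p0l'.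
have /= [_ up] := muP (lmu _ p0l) (r := 3 * r) ltac:(lra) ltac:(lra).
have sum_le : (\sum_(p <- l') mu (eball p r0) <= mu (eball p0 (3 * r)))%E.
  apply: measure_disjoint_eballs => //.
  - exact: filter_uniq.
  - by move=> p q /l'P[pl _] /l'P[ql _]; exact: dis.
  - move=> p /l'P[_ py] z; rewrite /eball/= => zp.
    have := enorm_triangle p z p0; have := enorm_triangle y p p0.
    by rewrite (enormB y p0); lra.
have lo : ((C^-1 * r0 `^ h *+ size l')%:E <= \sum_(p <- l') mu (eball p r0))%E.
  rewrite -(count_predT l') -iter_addr_0 -big_const_seq -sumEFin big_seq [leRHS]big_seq.
  apply: lee_sum => p /l'P[pl _].
  by have [] := muP (lmu _ pl) r00 ltac:(lra).
have := le_trans lo (le_trans sum_le up); rewrite lee_fin -mulr_natr.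
rewrite powR_div ?(ltW r00)//; last by lra.
have r0h : 0 < r0 `^ h by exact: powR_gt0.
rewrite mulrA ler_pdivlMr// => hh.
rewrite -(ler_pM2l (x := C^-1)) ?invr_gt0//.
have -> : C^-1 * (C ^+ 2 * ((3 * r) `^ h)) = C * (3 * r) `^ h.
  by field; rewrite gt_eqF.
by apply: le_trans hh; rewrite mulrA mulrAC mulrC.
Qed.

(** Up to a compact set that misses the support, hence is null, the ball of radius [r / 2] about [p]
    is covered by the balls of radius [del] about those points of [l] that are within [r] of [p]. *)
Lemma ahlfors_count_ge l (p : 'rV[R]_d) (r del : R) : msupport mu p ->
  (forall q, q \in l -> msupport mu q) -> 0 < del -> del <= r / 2 -> r <= 1 ->
  (forall y, msupport mu y -> exists2 q, q \in l & enorm (y - q) < del) ->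
  C ^- 2 * (r / 2 / del) `^ h <= (count (fun q => enorm (q - p) < r) l)%:R.
Proof.
move=> pmu lmu del0 delr r1 cov.
have [lo _] := muP pmu (r := r / 2) ltac:(lra) ltac:(lra).
pose G : set (@borelRd R d) := \bigcup_(q in [set q | q \in l]) eball q del.
have oG : open (G : set 'rV[R]_d) by apply: bigcup_open => q _; exact: eball_open.
pose K : set (@borelRd R d) := ecball p (r / 2) `&` ~` G.
have cK : compact (K : set 'rV[R]_d).
  apply: (subclosed_compact _ (@ecball_compact _ _ p (r / 2))) => [|z []//].
  by apply: closedI; [exact: ecball_closed|exact: open_closedC].
have K0 : mu K = 0%E.
  apply: compact_null => // x [_ nG] xmu; apply: nG.
  by have [q ql xq] := cov x xmu; exists q.
pose l' := [seq q <- l | enorm (q - p) < r].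
have mK : measurable K by exact: borelRd_compact.
have mU : measurable (\big[setU/set0]_(q <- l') (eball q del : set (@borelRd R d))).
  by apply: bigsetU_measurable => q _; exact: eball_meas.
have sub : eball p (r / 2) `<=` K `|` \big[setU/set0]_(q <- l') (eball q del).
  move=> z; rewrite /eball/= => zp.
  have [[q /= ql zq]|nG] := pselect (G z); last by left; split => //; rewrite /ecball/= ltW.
  right; rewrite -bigcup_seq; exists q => //=; rewrite mem_filter ql andbT.
  by have := enorm_triangle z q p; rewrite (enormB q z); move: zq; rewrite /eball/=; lra.
have up : (mu (eball p (r / 2)) <= \sum_(q <- l') (C * del `^ h)%:E)%E.
  apply: (@le_trans _ _ (mu (K `|` \big[setU/set0]_(q <- l') (eball q del)))).
    by apply: le_measure => //; rewrite inE//; exact: measurableU.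
  apply: le_trans (measureU2 mu mK mU) _.
  rewrite [X in (X + _)%E](_ : _ = 0%E); last exact: K0.
  rewrite add0e.
  apply: le_trans (measure_bigsetU_le _ (fun q => eball_meas q del)) _.
  rewrite big_seq [leRHS]big_seq; apply: lee_sum => q; rewrite mem_filter => /andP[_ ql].
  by have [] := muP (lmu _ ql) del0 ltac:(lra).
have := le_trans lo up; rewrite sumEFin lee_fin big_const_seq iter_addr_0 count_predT size_filter.
set N := count _ _; rewrite -(mulr_natr (C * del `^ h)) => hh.
have r20 : 0 <= r / 2 by lra.
set a := r / 2 in hh r20 *; rewrite (powR_div _ r20 (ltW del0)).
have dh : 0 < del `^ h by exact: powR_gt0.
rewrite mulrA ler_pdivrMr// -(ler_pM2l C0).
have -> : C * (C ^- 2 * a `^ h) = C^-1 * a `^ h by field; rewrite gt_eqF.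
by apply: le_trans hh _; rewrite [_%:R * _]mulrC mulrA.
Qed.

End AhlforsCounting.

(** * Contraction constants and Birkhoff sums *)

Section InfSup.
Context {R : realType} {U W : Type}.
Variables (A : set U) (B : set W) (g : U -> W -> R).

Lemma inf_inf_le a b : (forall a b, A a -> B b -> 0 <= g a b) -> A a -> B b ->
  inf [set inf [set g a b | b in B] | a in A] <= g a b.
Proof.
move=> g0 Aa Bb; apply: (@le_trans _ _ (inf [set g a b | b in B])).
  apply: ge_inf; last by exists a.
  exists 0 => _ [a' Aa' <-]; apply: lb_le_inf; first by exists (g a' b); exists b.
  by move=> _ [b' Bb' <-]; exact: g0.
apply: ge_inf; last by exists b.
by exists 0 => _ [b' Bb' <-]; exact: g0.
Qed.

Lemma le_inf_inf (c : R) : A !=set0 -> B !=set0 ->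
  (forall a b, A a -> B b -> c <= g a b) ->
  c <= inf [set inf [set g a b | b in B] | a in A].
Proof.
move=> [a Aa] [b Bb] cg; apply: lb_le_inf.
  by exists (inf [set g a b | b in B]); exists a.
move=> _ [a' Aa' <-]; apply: lb_le_inf; first by exists (g a' b); exists b.
by move=> _ [b' Bb' <-]; exact: cg.
Qed.

Lemma sup_sup_ge (c : R) a b : (forall a b, A a -> B b -> g a b <= c) -> A a -> B b ->
  g a b <= sup [set sup [set g a b | b in B] | a in A].
Proof.
move=> gc Aa Bb; apply: (@le_trans _ _ (sup [set g a b | b in B])).
  apply: ub_le_sup; last by exists b.
  by exists c => _ [b' Bb' <-]; exact: gc.
apply: ub_le_sup; last by exists a.
exists c => _ [a' Aa' <-]; apply: ge_sup; first by exists (g a' b); exists b.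
by move=> _ [b' Bb' <-]; exact: gc.
Qed.

End InfSup.

Lemma finite_common_lower {R : realType} (U : choiceType) (A : set U) (Q : U -> R -> Prop) :
  finite_set A -> (forall a c c', 0 < c' -> c' <= c -> Q a c -> Q a c') ->
  (forall a, A a -> exists2 c, 0 < c & Q a c) ->
  exists2 c, 0 < c & forall a, A a -> Q a c.
Proof.
move=> /finite_seqP[s ->] mon.
elim: s => [|a s ih] h; first by exists 1.
have [|c1 c10 h1] := ih; first by move=> b bs; apply: h; rewrite /= inE bs orbT.
have [|c2 c20 h2] := h a; first by rewrite /= mem_head.
have m0 : 0 < Num.min c1 c2 by rewrite lt_min c10.
exists (Num.min c1 c2) => // b; rewrite /= inE => /orP[/eqP ->|bs].
  by apply: mon h2 => //; rewrite ge_min lexx orbT.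
by apply: mon (h1 b bs) => //; rewrite ge_min lexx.
Qed.

Section Constants.
Context {R : realType} {d : nat} {T : choiceType}.
Variables (X V : set 'rV[R]_d) (I : nat -> set T) (phi : nat -> T -> 'rV[R]_d -> 'rV[R]_d).
Hypothesis d_gt0 : (0 < d)%N.
Hypothesis hifs : conformal_ifs X V I phi.
Variable K : R.
Hypothesis K1 : 1 <= K.
Hypothesis distortion : forall n w x y, (0 < n)%N -> words I 1 n w -> X x -> X y ->
  conformal_factor (word_map phi 1 w) x <= K * conformal_factor (word_map phi 1 w) y.
Implicit Types (u w : seq T) (x y : 'rV[R]_d).

Let XV : X `<=` V. Proof. by have [_ []] := hifs. Qed.
Let X0 : X !=set0.
Proof. by have [[_ _ [x Xx]] _ _ _] := hifs; exists x; exact: interior_subset. Qed.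
Let IP k : (0 < k)%N -> finite_set (I k) /\ I k !=set0.
Proof. by have [_ _ h _] := hifs => /h[]. Qed.

Lemma words_fin n : finite_set (words I 1 n).
Proof. by apply: words_finite => k /IP[]. Qed.

Lemma words_neq0 n : words I 1 n !=set0.
Proof. by apply: words_exist => k /IP[]. Qed.

Let wf_ge0 n w x : words I 1 n w -> X x -> 0 <= conformal_factor (word_map phi 1 w) x.
Proof.
by move=> [_ aw] /XV Vx; apply: ltW; exact: (word_factor_gt0 d_gt0 hifs (isT : (0 < 1)%N) aw).
Qed.

Lemma kappa_low_le n w x : words I 1 n w -> X x ->
  kappa_low X I phi n <= conformal_factor (word_map phi 1 w) x.
Proof.
exact: (@inf_inf_le R _ _ (words I 1 n) X (fun w x => conformal_factor (word_map phi 1 w) x) w x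
  (@wf_ge0 n)).
Qed.

Lemma kappa_up_ge n w x : words I 1 n w -> X x ->
  conformal_factor (word_map phi 1 w) x <= kappa_up X I phi n.
Proof.
apply: (@sup_sup_ge R _ _ (words I 1 n) X (fun w x => conformal_factor (word_map phi 1 w) x) 1 w x).
by move=> a b [_ aw] /XV Vb; exact: (word_factor_le1 d_gt0 hifs (isT : (0 < 1)%N) aw Vb).
Qed.

Lemma kappa_low_gt0 n : 0 < kappa_low X I phi n.
Proof.
have [||c c0 hc] := @finite_common_lower R _ (words I 1 n)
  (fun w c => forall x, X x -> c <= conformal_factor (word_map phi 1 w) x) (words_fin n).
- by move=> w c c' _ cc' h x Xx; apply: le_trans cc' (h x Xx).
- by move=> w [_ aw]; exact: (word_factor_lower d_gt0 hifs K1 distortion (isT : (0 < 1)%N) aw).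
apply: lt_le_trans c0 _; apply: le_inf_inf => [||w x ww Xx]; last exact: hc.
  exact: words_neq0.
exact: X0.
Qed.

Lemma le_kappa_low n (c : R) :
  (forall w x, words I 1 n w -> X x -> c <= conformal_factor (word_map phi 1 w) x) ->
  c <= kappa_low X I phi n.
Proof. by move=> h; apply: le_inf_inf => //; exact: words_neq0. Qed.

Let letter_X k j x : (0 < k)%N -> I k j -> X x ->
  0 < conformal_factor (phi k j) x /\ conformal_factor (phi k j) x <= 1.
Proof.
by move=> k0 Ij /XV Vx; have [_ [? _] ?] := letter_factor d_gt0 hifs k0 Ij Vx.
Qed.

Lemma kappa_low1_le k j x : (0 < k)%N -> I k j -> X x ->
  kappa_low1 X I phi k <= conformal_factor (phi k j) x.
Proof.
move=> k0; apply: (@inf_inf_le R _ _ (I k) X (fun j x => conformal_factor (phi k j) x) j x).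
by move=> a b Ia Xb; apply: ltW; have [] := letter_X k0 Ia Xb.
Qed.

Lemma kappa_up1_ge k j x : (0 < k)%N -> I k j -> X x ->
  conformal_factor (phi k j) x <= kappa_up1 X I phi k.
Proof.
move=> k0; apply: (@sup_sup_ge R _ _ (I k) X (fun j x => conformal_factor (phi k j) x) 1 j x).
by move=> a b Ia Xb; have [] := letter_X k0 Ia Xb.
Qed.

Lemma kappa_low1_gt0 k : (0 < k)%N -> 0 < kappa_low1 X I phi k.
Proof.
move=> k0; have [fI I0] := IP k0.
have [||c c0 hc] := @finite_common_lower R _ (I k)
  (fun j c => forall x, X x -> c <= conformal_factor (phi k j) x) fI.
- by move=> w c c' _ cc' h x Xx; apply: le_trans cc' (h x Xx).
- move=> j Ij; have aj : admissible I k [:: j] by [].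
  exact: (word_factor_lower d_gt0 hifs K1 distortion k0 aj).
apply: lt_le_trans c0 _; apply: le_inf_inf => //.
by move=> j x Ij Xx; exact: hc.
Qed.

(** * Birkhoff sums against contraction factors *)

Section Uniform.
Variable theta : R.
Hypothesis theta0 : 0 < theta.
Hypothesis contr : forall n, (0 < n)%N -> kappa_up1 X I phi n <= expR (- theta).

Lemma word_factor_exp m w x : (0 < m)%N -> admissible I m w -> X x ->
  conformal_factor (word_map phi m w) x <= expR (- theta) ^+ size w.
Proof.
elim: w m => [|a w ih] m m0 aw Xx; first by rewrite word_factor_nil.
rewrite (word_factor_cons d_gt0 hifs m0 aw (XV Xx)); case: aw => Ia aw.
have Xw := word_map_X hifs (isT : (0 < m.+1)%N) aw Xx.
rewrite exprS; apply: ler_pM; last exact: ih.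
- by apply: ltW; have [] := letter_X m0 Ia Xw.
- by apply: ltW; exact: (word_factor_gt0 d_gt0 hifs (isT : (0 < m.+1)%N) aw (XV Xx)).
- by apply: le_trans (kappa_up1_ge m0 Ia Xw) _; exact: contr.
Qed.

Lemma kappa_low_exp n : kappa_low X I phi n <= expR (- theta) ^+ n.
Proof.
have [w ww] := words_neq0 n; have [x Xx] := X0.
apply: le_trans (kappa_low_le ww Xx) _; have [sw aw] := ww.
by rewrite -[n in leRHS]sw; exact: (word_factor_exp (isT : (0 < 1)%N) aw Xx).
Qed.

Variables (beta : nat -> (nat -> T) -> R) (alow aup : R).
Hypothesis alow0 : 0 < alow.
Hypothesis beta_low : forall k z, (0 < k)%N -> infwords I k z ->
  alow <= beta k z + ln (kappa_low1 X I phi k).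
Hypothesis beta_up1 : forall k z, (0 < k)%N -> infwords I k z ->
  alow <= beta k z + ln (kappa_up1 X I phi k).
Hypothesis beta_up : forall k z, (0 < k)%N -> infwords I k z ->
  beta k z + ln (kappa_up1 X I phi k) <= aup.

Lemma birkhoffE n (z : nat -> T) :
  birkhoff beta n z = \sum_(i < n) beta i.+1 (iter i wshift z).
Proof. by rewrite /birkhoff big_add1/= big_mkord. Qed.

Lemma expR_beta_le k (z : nat -> T) : (0 < k)%N -> infwords I k z ->
  expR (- beta k z) <= kappa_low1 X I phi k.
Proof.
move=> k0 zI; rewrite -[leRHS]lnK ?posrE ?kappa_low1_gt0// ler_expR.
by have := beta_low k0 zI; have := alow0; lra.
Qed.

(** Letter by letter, [expR (- beta)] is below the smallest contraction factor, and the chain rule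
    multiplies these bounds. This is the source of [R_n <= r_n]. *)
Lemma expR_sum_beta_le m w x (z : nat -> T) : (0 < m)%N -> admissible I m w ->
  infwords I m z -> X x ->
  expR (- \sum_(i < size w) beta (m + i)%N (iter i wshift z)) <=
  conformal_factor (word_map phi m w) x.
Proof.
elim: w m z => [|a w ih] m z m0 aw zI Xx.
  by rewrite big_ord0 oppr0 expR0 word_factor_nil.
rewrite (word_factor_cons d_gt0 hifs m0 aw (XV Xx)); case: aw => Ia aw.
have Xw := word_map_X hifs (isT : (0 < m.+1)%N) aw Xx.
rewrite /= big_ord_recl/= addn0 opprD expRD.
apply: ler_pM; rewrite ?expR_ge0//.
  by apply: le_trans (expR_beta_le m0 zI) _; exact: kappa_low1_le.
have zI1 : infwords I m.+1 (wshift z) by have := @infwords_shift _ I m 1 z zI; rewrite addn1.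
apply: le_trans (ih m.+1 (wshift z) isT aw zI1 Xx); rewrite ler_expR lerN2.
apply: ler_sum => i _; rewrite /bump /= add1n addnS addSn -iterSr.
by [].
Qed.

Lemma expR_birkhoff_le n (z : nat -> T) : infwords I 1 z ->
  expR (- birkhoff beta n z) <= kappa_low X I phi n.
Proof.
move=> zI; apply: le_kappa_low => w x [sw aw] Xx.
have := expR_sum_beta_le (isT : (0 < 1)%N) aw zI Xx.
by rewrite sw birkhoffE.
Qed.

Let shift1 k (z : nat -> T) : infwords I 1 z -> infwords I k.+1 (iter k wshift z).
Proof. by move=> zI; rewrite -add1n; exact: infwords_shift. Qed.

Lemma birkhoff_ge n (z : nat -> T) : infwords I 1 z -> alow *+ n <= birkhoff beta n z.
Proof.
move=> zI; rewrite birkhoffE -[n in leLHS]card_ord -sumr_const; apply: ler_sum => i _.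
have := beta_up1 (isT : (0 < i.+1)%N) (shift1 i zI).
have : ln (kappa_up1 X I phi i.+1) <= 0.
  apply: ln_le0; apply: le_trans (contr (isT : (0 < i.+1)%N)) _.
  by rewrite -expR0 ler_expR oppr_le0 ltW.
by lra.
Qed.

(** Makes the supremum in the variation condition a genuine upper bound. *)
Lemma birkhoff_le n : exists c, forall z, infwords I 1 z -> birkhoff beta n z <= c.
Proof.
exists (\sum_(i < n) (aup - ln (kappa_up1 X I phi i.+1))) => z zI.
rewrite birkhoffE; apply: ler_sum => i _.
by have := beta_up (isT : (0 < i.+1)%N) (shift1 i zI); lra.
Qed.

End Uniform.
End Constants.

(** * Covers and limits superior *)

Section Covers.
Context {R : realType} {d : nat}.

Lemma diam_pow_eball (t r : R) (x : 'rV[R]_d) : 0 <= t -> 0 < r ->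
  (ediam (eball x r) <= (2 * r)%:E)%E /\
  (diam_pow t (eball x r) <= ((2 * r) `^ t)%:E)%E.
Proof.
move=> t0 r0; have dr : (ediam (eball x r) <= (2 * r)%:E)%E.
  apply: ge_ereal_sup => _ [[y z] [/= yr zr] <-]; rewrite lee_fin.
  have := enorm_triangle x y z; rewrite (enormB x z).
  by move: yr zr; rewrite /eball/=; lra.
split => //; rewrite /diam_pow; case: ifPn => [_|_]; first by rewrite lee_fin powR_ge0.
have e0 := ediam_ge0 (eballxx x r0).
rewrite -poweR_EFin; apply: gt0_ler_poweR => //; rewrite in_itv/= ?e0 ?leey//.
by rewrite lee_fin mulr_ge0 ?(ltW r0)// leey.
Qed.

(* The finite lists are concatenated into a single sequence; heading each of
   them with the empty set makes the first [m] lists provide [m] sets at least. *)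
Lemma hausdorff_measure_eq0 (D : set 'rV[R]_d) (t q : R) (B : nat -> seq ('rV[R]_d * R)) :
  0 <= t -> 0 <= q -> q < 1 ->
  (forall n b, b \in B n -> 0 < b.2) ->
  (forall N x, D x -> exists n b, [/\ (N <= n)%N, b \in B n & eball b.1 b.2 x]) ->
  (forall e, 0 < e -> exists N, forall n b, (N <= n)%N -> b \in B n -> b.2 <= e) ->
  (exists N, forall n, (N <= n)%N -> \sum_(b <- B n) b.2 `^ t <= q ^+ n) ->
  hausdorff_measure t D = 0%E.
Proof.
move=> t0 q0 q1 B0 DB Bsmall [N0 Bsum].
have content_ge0 e : (0 <= hausdorff_content t e D)%E.
  apply: le_ereal_inf_tmp => _ [U _ <-]; apply: nneseries_ge0 => i _ _.
  exact: diam_pow_ge0.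
apply/eqP; rewrite eq_le; apply/andP; split; last first.
  by apply: le_trans (content_ge0 1) _; apply: ereal_sup_ubound; exists 1 => //=.
apply: ge_ereal_sup => _ [e /= e0 <-]; apply/lee_addgt0Pr => eta eta0; rewrite add0e.
have [N1 hN1] := Bsmall (e / 2) ltac:(by rewrite divr_gt0).
(* Below this threshold for [q^N], the geometric tail [2^t q^N / (1 - q)] is less than [eta]; the
   factor [2^t] comes from diameters being at most twice the radii. *)
have c0 : 0 < eta * (1 - q) / 2 `^ t.
  by rewrite divr_gt0 ?powR_gt0// mulr_gt0// subr_gt0.
have qn : `|q| < 1 by rewrite ger0_norm.
have /cvgrPdist_lt/(_ _ c0)[N2 _ hN2] := cvg_expr qn.
pose N := maxn (maxn N0 N1) N2.
have NN0 : (N0 <= N)%N by rewrite !leq_max leqnn.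
have NN1 : (N1 <= N)%N by rewrite !leq_max leqnn orbT.
have NN2 : (N2 <= N)%N by rewrite !leq_max leqnn orbT.
have qN : q ^+ N < eta * (1 - q) / 2 `^ t.
  by have := hN2 N NN2; rewrite /= sub0r normrN ger0_norm ?exprn_ge0.
pose S k : seq (set 'rV[R]_d) := set0 :: [seq eball b.1 b.2 | b <- B (N + k)%N].
pose L m := flatten [seq S k | k <- iota 0 m].
have LS m : L m.+1 = L m ++ S m.
  rewrite /L.
  have -> : iota 0 m.+1 = iota 0 m ++ [:: m] by rewrite -addn1 iotaD.
  by rewrite map_cat flatten_cat /= cats0.
have sL m : (m <= size (L m))%N.
  elim: m => // m ih; rewrite LS size_cat /= addnS ltnS.
  exact: leq_trans ih (leq_addr _ _).
pose U i := nth set0 (L i.+1) i.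
have LU i m : (i < m)%N -> nth set0 (L m) i = U i.
  elim: m => // m ih; rewrite ltnS leq_eqVlt => /orP[/eqP -> //|im].
  by rewrite LS nth_cat (leq_trans im (sL m)) ih.
have LP m A : A \in L m -> A = set0 \/ exists k b, b \in B (N + k)%N /\ A = eball b.1 b.2.
  move=> /flattenP[s /mapP[k _ ->]]; rewrite inE => /orP[/eqP ->|/mapP[b bB ->]]; first by left.
  by right; exists k, b.
apply: (@le_trans _ _ (\sum_(0 <= i <oo) diam_pow t (U i))%E).
  apply: ereal_inf_lbound; exists U => //; split.
    move=> i; have /LP[->|[k [b [bB ->]]]] : U i \in L i.+1 by apply: mem_nth; exact: sL.
      by apply: ge_ereal_sup => _ [[y z] [[]]].
    have [h _] := @diam_pow_eball t b.2 b.1 t0 (B0 _ _ bB).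
    apply: le_trans h _; rewrite lee_fin.
    by have := hN1 _ _ (leq_trans NN1 (leq_addr k N)) bB; lra.
  move=> x /(DB N)[n [b [Nn bB xb]]].
  have bL : eball b.1 b.2 \in L (n - N).+1.
    rewrite LS mem_cat; apply/orP; right; rewrite inE; apply/orP; right.
    by apply/mapP; exists b => //; rewrite subnKC.
  exists (index (eball b.1 b.2) (L (n - N).+1)) => //.
  rewrite -(@LU _ (maxn (index (eball b.1 b.2) (L (n - N).+1)).+1 (n - N).+1)) ?leq_max ?leqnn//.
  have prefix m m' : (m <= m')%N -> exists s, L m' = L m ++ s.
    move=> /subnK <-; elim: (m' - m)%N => [|k [s Es]]; first by exists [::]; rewrite add0n cats0.
    by exists (s ++ S (k + m)%N); rewrite addSn LS Es catA.
  have [s ->] := prefix _ _ (leq_maxr (index (eball b.1 b.2) (L (n - N).+1)).+1 (n - N).+1).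
  by rewrite nth_cat index_mem bL nth_index.
apply: lime_le; first by apply: is_cvg_nneseries => i _ _; exact: diam_pow_ge0.
apply: nearW => m; rewrite big_mkord.
apply: (@le_trans _ _ (\sum_(A <- L m) diam_pow t A)%E).
  rewrite (big_nth set0) big_mkord.
  rewrite -(big_mkord xpredT (fun i => diam_pow t (U i))).
  rewrite -[leRHS](big_mkord xpredT (fun i => diam_pow t (nth set0 (L m) i))).
  rewrite (@big_cat_nat _ _ _ m 0 (size (L m)))//=.
  rewrite [X in (_ <= X + _)%E](_ : _ = \sum_(0 <= i < m) diam_pow t (U i))%E; last first.
    by rewrite big_nat [RHS]big_nat; apply: eq_bigr => i /andP[_ im]; rewrite LU.
  by rewrite leeDl// sume_ge0// => i _; exact: diam_pow_ge0.
apply: (@le_trans _ _ (\sum_(k < m) (2 `^ t * q ^+ (N + k))%:E)%E).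
  rewrite big_flatten/= big_map (_ : iota 0 m = index_iota 0 m) ?/index_iota ?subn0//.
  rewrite -[X in iota 0 X]subn0 -/(index_iota 0 m) big_mkord.
  apply: lee_sum => k _; rewrite big_cons /diam_pow eqxx add0e big_map.
  apply: (@le_trans _ _ (\sum_(b <- B (N + k)%N) (2 `^ t * b.2 `^ t)%:E)%E).
    rewrite big_seq [leRHS]big_seq; apply: lee_sum => b bB.
    have b0 := B0 _ _ bB; rewrite -powRM ?(ltW b0)//.
    by have [_] := @diam_pow_eball t b.2 b.1 t0 b0.
  rewrite sumEFin lee_fin -mulr_sumr ler_wpM2l ?powR_ge0// Bsum//.
  exact: leq_trans NN0 (leq_addr _ _).
rewrite sumEFin lee_fin.
have q1' : 0 < 1 - q by rewrite subr_gt0.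
rewrite -(ler_pM2r q1'); apply: le_trans (ltW (_ : 2 `^ t * q ^+ N < _)); last first.
  by rewrite mulrC -ltr_pdivlMr ?powR_gt0.
under eq_bigr do rewrite exprD mulrA.
rewrite -mulr_sumr -mulrA ler_piMr ?mulr_ge0 ?powR_ge0 ?exprn_ge0//.
by rewrite mulrC -opprB mulNr -subrX1 opprB gerBl exprn_ge0.
Qed.

End Covers.

Section LimSup.
Context {R : realType}.
Implicit Types u : nat -> R.

Lemma limn_esup_lt0 u : (limn_esup (fun n => (u n)%:E) < 0)%E ->
  exists2 c, 0 < c & exists N, forall n, (N <= n)%N -> u n <= - c.
Proof.
rewrite /limn_esup limf_esupE => /ereal_inf_lt[_ [A [N _ NA] <-] A0].
have uA n : (N <= n)%N -> ((u n)%:E <= ereal_sup [set (u n)%:E | n in A])%E.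
  by move=> Nn; apply: ereal_sup_ubound; exists n => //; exact: NA.
case: (ereal_sup _) A0 uA => [r| |] // r0 uA.
  exists (- r); first by rewrite oppr_gt0 -lte_fin.
  by exists N => n /uA; rewrite opprK lee_fin.
by exists 1 => //; exists N => n /uA.
Qed.

Lemma limn_esup_ge0 u : (0 <= limn_esup (fun n => (u n)%:E))%E ->
  forall (e : R) N, 0 < e -> exists2 n, (N <= n)%N & - e < u n.
Proof.
move=> u0 e N e0; apply: contrapT => no; move: u0; apply/negP; rewrite -ltNge.
apply: (@le_lt_trans _ _ (- e)%:E); last by rewrite lte_fin oppr_lt0.
rewrite /limn_esup limf_esupE; apply: ge_ereal_inf.
exists (ereal_sup [set (u n)%:E | n in [set n | (N <= n)%N]]).
  by exists [set n | (N <= n)%N] => //; exists N.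
apply: ge_ereal_sup => _ [n /= Nn <-]; rewrite lee_fin leNgt; apply/negP => h.
by apply: no; exists n.
Qed.

End LimSup.

(** * Target balls *)

Section CentreCounting.
Context {R : realType} {d : nat} {T : choiceType}.
Variables (X V : set 'rV[R]_d) (I : nat -> set T) (phi : nat -> T -> 'rV[R]_d -> 'rV[R]_d).
Hypothesis d_gt0 : (0 < d)%N.
Hypothesis hifs : conformal_ifs X V I phi.
Hypothesis hinj : forall n j, (0 < n)%N -> I n j -> set_inj V (phi n j).
Hypothesis osc : forall n i j, (0 < n)%N -> I n i -> I n j -> i <> j ->
  (phi n i @` X°) `&` (phi n j @` X°) = set0.
Variable K : R.
Hypothesis K1 : 1 <= K.
Hypothesis distortion : forall n w x y, (0 < n)%N -> words I 1 n w -> X x -> X y ->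
  conformal_factor (word_map phi 1 w) x <= K * conformal_factor (word_map phi 1 w) y.
Variable M : R.
Hypothesis M1 : 1 <= M.
Hypothesis homogeneous : forall n w x, (0 < n)%N -> words I 1 n w -> X x ->
  conformal_factor (word_map phi 1 w) x <= M * kappa_low X I phi n.
Variable xi : nat -> nat -> T.
Hypothesis xiI : forall n, (0 < n)%N -> infwords I n.+1 (xi n).
Variable eps : R.
Hypothesis eps0 : 0 < eps.
Hypothesis quasi_middle : forall n, (0 < n)%N -> eball (coding X phi n (xi n)) eps `<=` X.
Variables (mu : {measure set (@borelRd R d) -> \bar R}) (h Cmu : R).
Hypothesis Cmu1 : 1 <= Cmu.
Hypothesis muP : forall x, msupport mu x -> forall r : R, 0 < r -> r <= 1 ->
  ((Cmu^-1 * r `^ h)%:E <= mu (eball x r))%E /\ (mu (eball x r) <= (Cmu * r `^ h)%:E)%E.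
Hypothesis supp_mu : msupport mu = limit_set X I phi.

Let sep n := kappa_low X I phi n.
Let sep_gt0 n : 0 < sep n.
Proof. exact: (kappa_low_gt0 d_gt0 hifs K1 distortion). Qed.
Let Xc : compact X. Proof. by have [[]] := hifs. Qed.
Let Cmu0 : 0 < Cmu. Proof. exact: lt_le_trans Cmu1. Qed.

Definition word_list n : seq (seq T) := enum_fset (fset_set (words I 1 n)).

Definition centre n w : 'rV[R]_d := word_map phi 1 w (coding X phi n (xi n)).

Definition centres n : seq 'rV[R]_d := [seq centre n w | w <- word_list n].

Lemma mem_word_list n w : w \in word_list n <-> words I 1 n w.
Proof.
rewrite -[X in _ <-> X w](fset_setK (words_fin hifs n)).
by [].
Qed.

Lemma mem_centres n p : p \in centres n <-> exists2 w, words I 1 n w & p = centre n w.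
Proof.
split=> [/mapP[w /mem_word_list ww ->]|[w ww ->]]; first by exists w.
by apply/mapP; exists w => //; exact/mem_word_list.
Qed.

Lemma centres_neq0 n : centres n != [::].
Proof.
have [w ww] := words_neq0 hifs n.
have : centre n w \in centres n by apply/mem_centres; exists w.
by case: (centres n).
Qed.

Lemma centres_supp n p : (0 < n)%N -> p \in centres n -> msupport mu p.
Proof.
move=> n0 /mem_centres[w ww ->]; rewrite supp_mu.
by apply: (limit_set_coding d_gt0 hifs) => //; exact: xiI.
Qed.

Let middle_interior n y : (0 < n)%N -> eball (coding X phi n (xi n)) eps y -> X° y.
Proof. by move=> n0; apply: eball_interior; exact: quasi_middle. Qed.

(** The minimum with 1 gives [r0 n <= sep n], so the upper count applies at every radius from
    [sep n] on. *)
Let r0 n := sep n * Num.min eps 1.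

Let r0_gt0 n : 0 < r0 n.
Proof. by rewrite mulr_gt0// lt_min eps0 ltr01. Qed.

Lemma centre_ball n w : (0 < n)%N -> words I 1 n w ->
  eball (centre n w) (r0 n) `<=` word_map phi 1 w @` eball (coding X phi n (xi n)) eps.
Proof.
move=> n0 ww; have [_ aw] := ww.
have := @cylinder_ball _ _ _ _ _ _ _ d_gt0 hifs 1 w (coding X phi n (xi n)) eps (sep n)
  isT aw eps0 (sep_gt0 n) (@quasi_middle n n0) (fun y Xy => kappa_low_le d_gt0 hifs ww Xy).
apply: subset_trans => y; rewrite /eball/= => /lt_le_trans; apply.
by rewrite /r0 ler_wpM2l ?(ltW (sep_gt0 n))// ge_min lexx.
Qed.

Lemma centre_separated n w w' x y : (0 < n)%N -> words I 1 n w -> words I 1 n w' ->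
  eball (coding X phi n (xi n)) eps x -> eball (coding X phi n (xi n)) eps y ->
  word_map phi 1 w x = word_map phi 1 w' y -> w = w'.
Proof.
move=> n0 [sw aw] [sw' aw'] /(middle_interior n0) Xx /(middle_interior n0) Xy.
apply: (word_map_separated d_gt0 hifs hinj osc K1 distortion (isT : (0 < 1)%N) aw aw') => //.
by rewrite sw sw'.
Qed.

Lemma centres_uniq n : (0 < n)%N -> uniq (centres n).
Proof.
move=> n0; rewrite map_inj_in_uniq ?fset_uniq// => w w' /mem_word_list ww /mem_word_list ww'.
by apply: (centre_separated n0 ww ww'); exact: eballxx.
Qed.

Lemma centres_disjoint n p q : (0 < n)%N -> p \in centres n -> q \in centres n -> p <> q ->
  eball p (r0 n) `&` eball q (r0 n) = set0.
Proof.
move=> n0 /mem_centres[w ww ->] /mem_centres[w' ww' ->] ne.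
apply/seteqP; split => // z [/(centre_ball n0 ww)[a ha <-] /(centre_ball n0 ww')[b hb ba]].
by apply: ne; rewrite (centre_separated n0 ww' ww hb ha ba).
Qed.

(** The upper Ahlfors count with disjoint balls of radius [r0 n]; the ratio [r0 n / sep n] does not
    depend on [n] and goes into the constant. *)
Lemma centres_count_le : exists2 C, 1 <= C & forall n y r, (0 < n)%N -> sep n <= r -> r <= 3^-1 ->
  near_count centres n y r <= C * (r / sep n) `^ h.
Proof.
pose e1 := Num.min eps 1; have e10 : 0 < e1 by rewrite lt_min eps0 ltr01.
exists (1 + Cmu ^+ 2 * (3 / e1) `^ h).
  by rewrite lerDl mulr_ge0 ?exprn_ge0 ?powR_ge0// ltW.
move=> n y r n0 sr r3; have r_gt0 : 0 < r by exact: lt_le_trans sr.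
have r0r : r0 n <= r.
  by apply: le_trans sr; rewrite /r0 ler_piMr ?(ltW (sep_gt0 n))// ge_min lexx orbT.
have := ahlfors_count_le Cmu1 muP y (centres_uniq n0) (fun p => @centres_supp n p n0)
  (r0_gt0 n) r0r r3 (fun p q pl ql => @centres_disjoint n p q n0 pl ql).
move/le_trans; apply.
have -> : 3 * r / r0 n = 3 / e1 * (r / sep n).
  by rewrite /r0 -/e1; field; rewrite (gt_eqF e10) (gt_eqF (sep_gt0 n)).
rewrite powRM ?divr_ge0 ?(ltW e10) ?(ltW (sep_gt0 n)) ?(ltW r_gt0)// mulrA.
by rewrite ler_wpM2r ?powR_ge0// lerDr.
Qed.

(** A point of the support lies in some cylinder of level [n], whose diameter is at most
    [M * sep n * D] and which contains its own centre. The summand 1 makes the inequality strict. *)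
Lemma centres_dense : exists2 A, 0 < A & forall n y, (0 < n)%N -> msupport mu y ->
  exists2 q, q \in centres n & enorm (y - q) < A * sep n.
Proof.
have [D D0 XD] := compact_enorm_bounded Xc.
exists (M * D + 1) => [|n y n0]; first by rewrite ltr_wpDl// mulr_ge0 ?(ltW D0) ?(le_trans ler01).
rewrite supp_mu => /(_ n n0)[w ww [x Xx <-]]; exists (centre n w).
  by apply/mem_centres; exists w.
have Xc' : X (coding X phi n (xi n)) by apply: (coding_X d_gt0 hifs); exact: xiI.
have [_ aw] := ww.
have := cylinder_lipschitz d_gt0 hifs (isT : (0 < 1)%N) aw
  (fun z Xz => homogeneous n0 ww Xz) Xc' Xx.
move/le_lt_trans; apply.
apply: (@le_lt_trans _ _ (M * sep n * D)).
  by rewrite ler_wpM2l ?mulr_ge0 ?(ltW (sep_gt0 n)) ?(le_trans ler01)// XD.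
by rewrite mulrDl mul1r mulrAC ltrDl.
Qed.

Variable theta : R.
Hypothesis theta0 : 0 < theta.
Hypothesis contr : forall n, (0 < n)%N -> kappa_up1 X I phi n <= expR (- theta).

Lemma sep_small (e : R) : 0 < e -> exists N, forall n, (N <= n)%N -> sep n < e.
Proof.
move=> e0; have q1 : `|expR (- theta)| < 1.
  by rewrite ger0_norm ?expR_ge0// -expR0 ltr_expR oppr_lt0.
have /cvgrPdist_lt/(_ e e0)[N _ hN] := cvg_expr q1.
exists N => n Nn; have := hN n Nn; rewrite /= sub0r normrN ger0_norm ?exprn_ge0 ?expR_ge0//.
apply: le_lt_trans; exact: (kappa_low_exp d_gt0 hifs contr).
Qed.

(** The lower Ahlfors count at radius [r / 2] with mesh [A * sep m]. The mesh must be at most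
    [r / 4], hence the threshold on [m] and the factor [4 * A]. *)
Lemma centres_count_ge : exists2 C, 1 <= C & forall n p (r : R), (0 < n)%N -> p \in centres n ->
  0 < r -> r <= 1 -> exists N, forall m, (N <= m)%N ->
    C^-1 * (r / sep m) `^ h <= near_count centres m p (r / 2).
Proof.
have [A A0 dense] := centres_dense.
have c0 : 0 < Cmu ^+ 2 * (4 * A) `^ h by rewrite mulr_gt0 ?exprn_gt0// powR_gt0 ?mulr_gt0.
exists (1 + Cmu ^+ 2 * (4 * A) `^ h) => [|n p r n_gt0 pn r_gt0 r1]; first by rewrite lerDl ltW.
have [|N hN] := @sep_small (r / (4 * A)); first by rewrite divr_gt0 ?mulr_gt0.
exists (maxn N 1) => m; rewrite geq_max => /andP[Nm m0].
have dr : A * sep m <= r / 2 / 2.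
  have := hN m Nm; rewrite ltr_pdivlMr ?mulr_gt0// => hs; apply: ltW.
  by rewrite -(ltr_pM2l (x := 4))//; lra.
have := ahlfors_count_ge Cmu1 muP (centres_supp n_gt0 pn)
  (fun q => @centres_supp m q m0) (mulr_gt0 A0 (sep_gt0 m)) dr _ (fun y => dense m y m0).
move=> /(_ ltac:(lra)); apply: le_trans.
have -> : r / 2 / 2 / (A * sep m) = r / sep m / (4 * A).
  by field; rewrite (gt_eqF A0) (gt_eqF (sep_gt0 m)).
rewrite (@powR_div _ (r / sep m)) ?divr_ge0 ?(ltW r_gt0) ?(ltW (sep_gt0 m)) ?mulr_ge0 ?(ltW A0)//.
have A4 : 0 < (4 * A) `^ h by rewrite powR_gt0// mulr_gt0.
rewrite mulrC [leRHS]mulrCA ler_wpM2l ?powR_ge0//.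
rewrite -invfM lef_pV2 ?posrE ?ltr_wpDl//.
by rewrite lerDr.
Qed.

(** The upper count only reaches radius [3^-1], so all centres of level [n] are distributed over the
    balls of that radius about the centres of a fixed level [m], chosen with [A * sep m < 3^-1]. *)
Lemma centres_size_le : exists2 C, 0 < C & exists N, forall n, (N <= n)%N ->
  (size (centres n))%:R * sep n `^ h <= C.
Proof.
have [A A0 dense] := centres_dense; have [C C1 count_le] := centres_count_le.
have [|N1 hN1] := @sep_small (3^-1 / A); first by rewrite divr_gt0.
have [|N2 hN2] := @sep_small 3^-1; first by lra.
pose m := N1.+1.
have C0 : 0 < C by exact: lt_le_trans C1.
exists ((size (centres m))%:R * (C * 3^-1 `^ h) + 1).
  by rewrite ltr_wpDl// !mulr_ge0 ?powR_ge0// ltW.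
exists (maxn N2 1) => n; rewrite geq_max => /andP[Nn n0].
have Am : A * sep m < 3^-1 by rewrite mulrC -ltr_pdivlMr// hN1// leqnSn.
have sn := hN2 n Nn.
apply: (@le_trans _ _ ((size (centres m))%:R * (C * 3^-1 `^ h))); last by rewrite lerDl.
have -> : (size (centres m))%:R * (C * 3^-1 `^ h) =
  \sum_(q <- centres m) (C * (3^-1 / sep n) `^ h) * sep n `^ h.
  rewrite powR_div ?invr_ge0 ?(ltW (sep_gt0 n))//.
  rewrite big_const_seq iter_addr_0 count_predT -mulrA mulfVK ?gt_eqF ?powR_gt0//.
  by rewrite mulr_natl.
rewrite -mulr_suml ler_wpM2r ?powR_ge0//.
apply: (@le_trans _ _ (\sum_(q <- centres m) near_count centres n q 3^-1)).
  rewrite /near_count -natr_sum ler_nat.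
  (* Double counting of the pairs at distance less than [3^-1]. *)
  have -> : \sum_(q <- centres m) count (fun p => enorm (p - q) < 3^-1) (centres n) =
      \sum_(p <- centres n) count (fun q => enorm (p - q) < 3^-1) (centres m).
    under eq_bigr do rewrite -sum1_count big_mkcond/=.
    rewrite exchange_big/=; apply: eq_bigr => p _.
    by rewrite -sum1_count [RHS]big_mkcond.
  rewrite -sum1_size big_seq [leqRHS]big_seq; apply: leq_sum => p pn.
  have [q qm pq] := dense m p (isT : (0 < m)%N) (centres_supp n0 pn).
  by rewrite -has_count; apply/hasP; exists q => //; exact: lt_trans pq Am.
by apply: ler_sum => q _; apply: count_le => //; exact: ltW.
Qed.

Variables (beta : nat -> (nat -> T) -> R) (alow aup : R).
Hypothesis alow0 : 0 < alow.
Hypothesis beta_low : forall k z, (0 < k)%N -> infwords I k z ->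
  alow <= beta k z + ln (kappa_low1 X I phi k).
Hypothesis beta_up1 : forall k z, (0 < k)%N -> infwords I k z ->
  alow <= beta k z + ln (kappa_up1 X I phi k).
Hypothesis beta_up : forall k z, (0 < k)%N -> infwords I k z ->
  beta k z + ln (kappa_up1 X I phi k) <= aup.

Let supS n := sup [set birkhoff beta n z | z in infwords I 1].
Let infS n := inf [set birkhoff beta n z | z in infwords I 1].

Hypothesis variation : (fun n : nat => n%:R^-1 * (supS n - infS n)) @ \oo --> (0 : R).

Let birkhoff_lb n z : infwords I 1 z -> alow *+ n <= birkhoff beta n z.
Proof. by move=> zI; exact: (birkhoff_ge theta0 contr beta_up1 n zI). Qed.

Let word_I n w : (0 < n)%N -> words I 1 n w -> infwords I 1 (word_cat w (xi n)).
Proof. by move=> n0 ww; apply: word_cat_infwords ww _; exact: xiI. Qed.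

Let supS_ge n z : infwords I 1 z -> birkhoff beta n z <= supS n.
Proof.
move=> zI; apply: ub_le_sup; last by exists z.
have [c hc] := birkhoff_le beta_up n.
by exists c => _ [z' zI' <-]; exact: hc.
Qed.

Let infS_le n z : infwords I 1 z -> infS n <= birkhoff beta n z.
Proof.
move=> zI; apply: ge_inf; last by exists z.
by exists (alow *+ n) => _ [z' zI' <-]; exact: birkhoff_lb.
Qed.

Let supS_lb n : alow *+ n <= supS n.
Proof.
have [w ww] := words_neq0 hifs 1.
have zI := word_I (isT : (0 < 1)%N) ww.
exact: le_trans (birkhoff_lb n zI) (supS_ge n zI).
Qed.

Let level_sum n (t : R) : R :=
  \sum_(w <- word_list n) expR (- (t * birkhoff beta n (word_cat w (xi n)))).

Lemma upper_pressureE (t : R) :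
  upper_pressure I beta xi t = limn_esup (fun n => (n%:R^-1 * ln (level_sum n t))%:E).
Proof.
rewrite /upper_pressure; congr limn_esup; apply/funext => n.
by rewrite fsbig_finite//; exact: (words_fin hifs).
Qed.

Lemma level_sum_gt0 n t : 0 < level_sum n t.
Proof.
have [w /mem_word_list wW] := words_neq0 hifs n.
rewrite /level_sum (big_rem w)//= ltr_wpDr ?expR_gt0//.
by apply: sumr_ge0 => w' _; exact: expR_ge0.
Qed.

Lemma target_set_measure_eq0 (t : R) : 0 <= t -> (upper_pressure I beta xi t < 0)%E ->
  hausdorff_measure t (target_set X I phi beta xi) = 0%E.
Proof.
move=> t0; rewrite upper_pressureE => /limn_esup_lt0[c c0 [N hN]].
(* Level 0 is left empty, since [xi 0] is unconstrained. *)
pose B n := if n is 0%N then [::] else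
  [seq (centre n w, expR (- birkhoff beta n (word_cat w (xi n)))) | w <- word_list n].
have BP n b : b \in B n -> exists w, [/\ (0 < n)%N, words I 1 n w &
    b = (centre n w, expR (- birkhoff beta n (word_cat w (xi n))))].
  by case: n => // n /mapP[w /mem_word_list ww ->]; exists w.
apply: (@hausdorff_measure_eq0 _ _ _ t (expR (- c)) B) => //.
- by rewrite -expR0 ltr_expR oppr_lt0.
- by move=> n b /BP[w [_ _ ->]]; exact: expR_gt0.
- move=> k x /(_ k.+1 isT)[[|n]//= kn [w ww xb]].
  exists n.+1, (centre n.+1 w, expR (- birkhoff beta n.+1 (word_cat w (xi n.+1)))).
  split => //; first exact: ltnW.
  by apply/mapP; exists w => //; exact/mem_word_list.
- move=> e e0; have q1 : `|expR (- alow)| < 1.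
    by rewrite ger0_norm ?expR_ge0// -expR0 ltr_expR oppr_lt0.
  have /cvgrPdist_lt/(_ e e0)[N' _ hN'] := cvg_expr q1.
  exists N' => n b Nn /BP[w [n0 ww ->]] /=.
  have := hN' n Nn; rewrite /= sub0r normrN ger0_norm ?exprn_ge0 ?expR_ge0// => /ltW.
  apply: le_trans; rewrite -expRM_natl ler_expR mulrN lerN2 mulr_natl.
  by apply: birkhoff_lb; exact: word_I.
- exists (maxn N 1) => -[|n]; first by rewrite leqNgt leq_max orbT.
  rewrite geq_max => /andP[Nn _]; rewrite /B big_map.
  have -> : \sum_(w <- word_list n.+1)
      (centre n.+1 w, expR (- birkhoff beta n.+1 (word_cat w (xi n.+1)))).2 `^ t =
      level_sum n.+1 t.
    by apply: eq_bigr => w _; rewrite powR_expR mulrN.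
  have := hN n.+1 Nn; rewrite mulrC ler_pdivrMr ?ltr0n// => hle.
  rewrite -[leLHS]lnK ?posrE ?level_sum_gt0// -expRM_natl ler_expR.
  by rewrite mulrC.
Qed.

(** The level sum is at most the number of words times [expR (- (t * infS n))], while the pressure
    bounds it from below by [expR (- (eta * n))] for infinitely many [n]. *)
Lemma many_words (s t : R) : 0 <= t -> s < t -> (0 <= upper_pressure I beta xi t)%E ->
  forall N, exists n, [/\ (N <= n)%N, (0 < n)%N &
    expR (s * supS n) <= (size (word_list n))%:R].
Proof.
move=> t0 st; rewrite upper_pressureE => press N.
have t1 : 0 < t + 1 by rewrite ltr_wpDl.
(* Chosen so that [(t + 1) * eta = (t - s) * alow]: replacing [infS n] by [supS n] costs
   [t * eta * n], the pressure defect costs [eta * n], and lowering [t] to [s] gains at least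
   [(t - s) * alow * n]. *)
pose eta := (t - s) * alow / (t + 1).
have eta0 : 0 < eta by rewrite divr_gt0// mulr_gt0// subr_gt0.
have /cvgrPdist_lt/(_ _ eta0)[N1 _ hN1] := variation.
have [n] := limn_esup_ge0 press (maxn (maxn N N1) 1) eta0.
rewrite !geq_max => /andP[/andP[Nn N1n] n0] hn.
exists n; split => //; have n0' : 0 < n%:R :> R by rewrite ltr0n.
have var : supS n - infS n <= eta * n%:R.
  have := hN1 n N1n; rewrite /= sub0r normrN => /ltW/(le_trans (ler_norm _)).
  by rewrite mulrC ler_pdivrMr.
have sum_lb : expR (- (eta * n%:R)) <= level_sum n t.
  rewrite -[leRHS]lnK ?posrE ?level_sum_gt0// ler_expR ltW//.
  by move: hn; rewrite mulrC ltr_pdivlMr// mulNr.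
have sum_ub : level_sum n t <= (size (word_list n))%:R * expR (- (t * infS n)).
  rewrite mulr_natl -(count_predT (word_list n)) -iter_addr_0 -big_const_seq.
  rewrite /level_sum big_seq [leRHS]big_seq; apply: ler_sum => w /mem_word_list ww.
  rewrite ler_expR lerN2 ler_wpM2l//; apply: infS_le; exact: word_I.
have := le_trans sum_lb sum_ub; rewrite -ler_pdivrMr ?expR_gt0//; apply: le_trans.
rewrite -expRN -expRD ler_expR opprK.
have big : n%:R * alow <= supS n by rewrite mulr_natl.
have e1 : (t + 1) * eta = (t - s) * alow by rewrite /eta; field; rewrite gt_eqF.
have h1 : t * supS n - t * infS n <= t * (eta * n%:R).
  by rewrite -mulrBr ler_wpM2l.
have h2 : (t - s) * (n%:R * alow) <= (t - s) * supS n.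
  by rewrite ler_wpM2l// subr_ge0 ltW.
have h3 : (t - s) * (n%:R * alow) = (t + 1) * eta * n%:R by rewrite e1; ring.
lra.
Qed.

Lemma target_set_measure_neq0 (s0 t : R) : 0 <= s0 -> s0 < t ->
  (0 <= upper_pressure I beta xi t)%E ->
  hausdorff_measure s0 (target_set X I phi beta xi) <> 0%E.
Proof.
move=> s00 s0t press.
have t0 : 0 <= t by apply: le_trans (ltW s0t).
pose s := (2 * s0 + t) / 3; pose s' := (s0 + 2 * t) / 3.
have s0s : s0 < s by rewrite /s; lra.
have ss' : s < s' by rewrite /s /s'; lra.
have s't : s' < t by rewrite /s'; lra.
(* The supremum gives one radius for all words of the level; halving it puts the closed ball of
   radius [rad n] about a centre inside the open target ball of its word. *)
pose rad n := expR (- supS n) / 2.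
have rad_gt0 n : (0 < n)%N -> 0 < rad n by rewrite divr_gt0// expR_gt0.
have rad_le n z : infwords I 1 z -> 2 * rad n <= expR (- birkhoff beta n z).
  move=> zI; rewrite /rad mulrC mulfVK// ler_expR lerN2; exact: supS_ge.
have rad_le_sep n : (0 < n)%N -> rad n <= sep n.
  move=> n0; have [w ww] := words_neq0 hifs n; have zI := word_I n0 ww.
  have := expR_birkhoff_le d_gt0 hifs K1 distortion alow0 beta_low n zI.
  by have := rad_le n _ zI; have := rad_gt0 n n0; rewrite /sep; lra.
have [C1 C11 hC1] := centres_count_le.
have [C2 C21 hC2] := centres_count_ge.
have [C3 C30 [N3 hC3]] := centres_size_le.
have c3 : 0 <= C3 * 2 `^ s' by rewrite mulr_ge0 ?powR_ge0// ltW.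
pose C := C1 + C2 + C3 * 2 `^ s'.
have C_ge1 : 1 <= C by rewrite /C; lra.
have sep_rad N : exists n, (N <= n)%N /\ sep n `^ h <= C * rad n `^ s'.
  have [n [Nn n0 hn]] := many_words t0 s't press (maxn N N3).
  move: Nn; rewrite geq_max => /andP[Nn N3n]; exists n; split => //.
  have := hC3 n N3n; rewrite size_map => hs.
  have : expR (s' * supS n) * sep n `^ h <= C3.
    by apply: le_trans hs; rewrite ler_wpM2r ?powR_ge0.
  rewrite mulrC -ler_pdivlMr ?expR_gt0// => /le_trans; apply.
  rewrite /rad powR_div ?expR_ge0// powR_expR mulrN expRN.
  rewrite [leRHS](_ : _ = C / 2 `^ s' / expR (s' * supS n)); last by ring.
  rewrite ler_wpM2r ?invr_ge0 ?expR_ge0// ler_pdivlMr ?powR_gt0//.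
  by rewrite /C; lra.
(* Otherwise [sep_rad] and [rad n <= sep n] give [1 <= C * sep n ^ (s' - h)] at arbitrarily deep
   levels, although [sep n] tends to 0. *)
have sh : s <= h.
  rewrite leNgt; apply/negP => hs.
  have C2_gt0 : 0 < 2 * C by lra.
  have sh_gt0 : 0 < s' - h by lra.
  have [e e0 he] := powR_small C2_gt0 sh_gt0.
  have [N hN] := sep_small e0.
  have [n [Nn hn]] := sep_rad (maxn N 1); move: Nn; rewrite geq_max => /andP[Nn n0].
  have := he (sep n) (ltW (sep_gt0 n)) (ltW (hN n Nn)).
  have : sep n `^ h <= C * (sep n `^ (s' - h) * sep n `^ h).
    rewrite -powRD ?subrK; last by rewrite (gt_eqF (sep_gt0 n)) implybT.
    apply: le_trans hn _; rewrite ler_wpM2l//; first by lra.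
    apply: ge0_ler_powR; rewrite ?nnegrE ?(ltW (sep_gt0 n)) ?rad_le_sep//; first by lra.
    exact: ltW (rad_gt0 n n0).
  rewrite mulrA -{1}[sep n `^ h]mul1r ler_pM2r ?powR_gt0//; lra.
have h0 : 0 <= h by lra.
apply: (@limsup_balls_hausdorff R d centres rad sep h C h0 C_ge1 rad_gt0 rad_le_sep
  _ _ _ s0 s s') => //.
- move=> n y r n0 sr r3; apply: le_trans (hC1 n y r n0 sr r3) _.
  by rewrite ler_wpM2r ?powR_ge0//; rewrite /C; lra.
- move=> n p n0 pn r1; have [N hN] := hC2 n p (rad n) n0 pn (rad_gt0 n n0) r1.
  exists N => m Nm; apply: le_trans (hN m Nm).
  by rewrite ler_wpM2r ?powR_ge0// lef_pV2 ?posrE; rewrite /C; lra.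
- exact: sep_small.
- by move=> n _; exact: centres_neq0.
- move=> x hx k k0; have [n [p [kn /mem_centres[w ww ->] xp]]] := hx k.
  have n0 : (0 < n)%N by exact: leq_trans kn.
  exists n => //; exists w => //; rewrite /eball/=.
  apply: lt_le_trans (rad_le n _ (word_I n0 ww)); apply: le_lt_trans xp _.
  by have := rad_gt0 n n0; lra.
Qed.

End CentreCounting.

(** * The dimension formula *)

Unset Implicit Arguments.

Theorem theorem4p3 (R : realType) (d : nat) (hd : (0 < d)%N) (T : choiceType)
  (X V : set 'rV[R]_d) (I : nat -> set T)
  (phi : nat -> T -> 'rV[R]_d -> 'rV[R]_d)
  (hifs : conformal_ifs X V I phi)
  (hinj : forall n j, (0 < n)%N -> I n j -> set_inj V (phi n j))
  (beta : nat -> (nat -> T) -> R)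
  (hbeta : forall n xi, (0 < n)%N -> infwords I n xi -> 0 < beta n xi)
  (xi : nat -> nat -> T)
  (hxi : forall n, (0 < n)%N -> infwords I n.+1 (xi n))
  (* open set condition *)
  (h1 : forall n i j, (0 < n)%N -> I n i -> I n j -> i <> j ->
    (phi n i @` X°) `&` (phi n j @` X°) = set0)
  (* uniform contraction *)
  (h2 : exists theta : R, 0 < theta /\
    forall n, (0 < n)%N -> kappa_up1 X I phi n <= expR (- theta))
  (* exponentially shrinking condition *)
  (h3 : exists alow aup : R, 0 < alow /\
    forall k z, (0 < k)%N -> infwords I k z ->
      [/\ alow <= beta k z + ln (kappa_low1 X I phi k),
          beta k z + ln (kappa_low1 X I phi k)
            <= beta k z + ln (kappa_up1 X I phi k) &
          beta k z + ln (kappa_up1 X I phi k) <= aup])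
  (* linear variation condition *)
  (h4 : (fun n : nat => n%:R^-1 *
      (sup [set birkhoff beta n z | z in infwords I 1]
       - inf [set birkhoff beta n z | z in infwords I 1])) @ \oo --> (0 : R))
  (* non-empty quasi middle *)
  (h5 : exists eps : R, [/\ 0 < eps,
    forall n, (0 < n)%N ->
      (tail_limit_set X I phi n `&` inner_part X eps) !=set0 &
    forall n, (0 < n)%N ->
      (tail_limit_set X I phi n `&` inner_part X eps) (coding X phi n (xi n))])
  (* bounded distortion *)
  (h6 : exists K : R, 1 <= K /\
    forall n w x y, (0 < n)%N -> words I 1 n w -> X x -> X y ->
      conformal_factor (word_map phi 1 w) x <= K * conformal_factor (word_map phi 1 w) y)
  (h7 : exists M : R, forall n, (0 < n)%N ->
    kappa_up X I phi n / kappa_low X I phi n <= M)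
  (h8 : exists (h : R) (mu : {measure set (@borelRd R d) -> \bar R}),
    [/\ h%:E = hausdorff_dim (limit_set X I phi), ahlfors_regular h mu &
        msupport mu = limit_set X I phi]) :
  hausdorff_dim (target_set X I phi beta xi) = bowen I beta xi.
Proof.
have [theta [theta0 contr]] := h2.
have [alow [aup [alow0 hb]]] := h3.
have [eps [eps0 _ mid]] := h5.
have [K [K1 dist]] := h6.
have [M0 hM0] := h7.
have [h [mu [_ [Cmu [Cmu1 muP]] supp_mu]]] := h8.
have beta_low k z : (0 < k)%N -> infwords I k z ->
    alow <= beta k z + ln (kappa_low1 X I phi k).
  by move=> k0 zI; have [] := hb k z k0 zI.
have beta_up1 k z : (0 < k)%N -> infwords I k z ->
    alow <= beta k z + ln (kappa_up1 X I phi k).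
  by move=> k0 zI; have [lo mi _] := hb k z k0 zI; exact: le_trans lo mi.
have beta_up k z : (0 < k)%N -> infwords I k z ->
    beta k z + ln (kappa_up1 X I phi k) <= aup.
  by move=> k0 zI; have [] := hb k z k0 zI.
have M1 : 1 <= Num.max M0 1 by rewrite le_max lexx orbT.
have homog n w x : (0 < n)%N -> words I 1 n w -> X x ->
    conformal_factor (word_map phi 1 w) x <= Num.max M0 1 * kappa_low X I phi n.
  move=> n0 ww Xx; apply: le_trans (kappa_up_ge hd hifs ww Xx) _.
  rewrite -ler_pdivrMr; last exact: (kappa_low_gt0 hd hifs K1 dist).
  by apply: le_trans (hM0 n n0) _; rewrite le_max lexx.
(* By symmetry of the distance, a point of [inner_part X eps] has its whole [eps]-ball in [X]. *)
have middle n : (0 < n)%N -> eball (coding X phi n (xi n)) eps `<=` X.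
  move=> n0 y yx; have [_ [Xc notin]] := mid n n0; apply: contrapT => Xy.
  by apply: notin; exists y => //; rewrite /eball/= enormB.
apply/eqP; rewrite eq_le; apply/andP; split.
  apply: le_ereal_inf_tmp => _ [t [t0 pt] <-]; apply: ereal_inf_lbound.
  exists t => //; split => //.
  exact: (target_set_measure_eq0 hifs hxi theta0 contr alow0 beta_up1).
(* Zero measure at [s] excludes nonnegative pressure at [s + e], so the Bowen parameter is at most
   [s + e] for every [e > 0]. *)
apply: le_ereal_inf_tmp => _ [s [s0 Hs] <-]; apply/lee_addgt0Pr => e e0.
have [pt|pt] := ltP (upper_pressure I beta xi (s + e)) 0%E.
  by apply: ereal_inf_lbound; exists (s + e) => //; split => //; rewrite addr_ge0// ltW.
exfalso; apply: (target_set_measure_neq0 hd hifs hinj h1 K1 dist M1 homog hxi eps0 middle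
  Cmu1 muP supp_mu theta0 contr alow0 beta_low beta_up1 beta_up h4 s0 _ pt Hs).
by rewrite ltrDl.
Qed.
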